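(* Let $\boldsymbol\omega=(\boldsymbol\omega_0,\boldsymbol\omega_1,\boldsymbol\omega_2):\mathbb{S}^2\to\mathbb{S}^4$ be a nonconstant $\mathbb{S}^1$-equivariant and not linearly full harmonic map, and let $d\in\mathbb{Z}$ be such that $\frac12\int_{\mathbb{S}^2}|\nabla_T\boldsymbol\omega|^2\,d\mathrm{vol}=4\pi|d|$. Then one of the following holds: (i) either $\boldsymbol\omega_2\equiv0$, $\deg\boldsymbol\omega=d=\pm1$ (as a map into $\mathbb{S}^2_{(1)}$), and for some $\mu_1\in\mathbb{C}\setminus\{0\}$ we have $$\boldsymbol\omega\big(\boldsymbol\sigma_2^{-1}(z)\big)=\pm\boldsymbol\omega^{(1)}_{\rm eq}\big(\boldsymbol\sigma_2^{-1}(\mu_1z)\big),$$ with the $+$ sign if $\boldsymbol\omega(S^{(2)})=S^{(4)}$, and the $-$ sign if $\boldsymbol\omega(S^{(2)})=-S^{(4)}$; (ii) or $\boldsymbol\omega_1\equiv0$, $\deg\boldsymbol\omega=d=\pm2$ (as a map into $\mathbb{S}^2_{(2)}$), and for some $\mu_2\in\mathbb{C}\setminus\{0\}$ we have $$\boldsymbol\omega\big(\boldsymbol\sigma_2^{-1}(z)\big)=\pm\boldsymbol\omega^{(2)}_{\rm eq}\big(\boldsymbol\sigma_2^{-1}(\mu_2z^2)\big),$$ with the $+$ sign if $\boldsymbol\omega(S^{(2)})=S^{(4)}$, and the $-$ sign if $\boldsymbol\omega(S^{(2)})=-S^{(4)}$. Here $\boldsymbol\omega^{(1)}_{\rm eq}:\mathbb{S}^2\to\mathbb{S}^2_{(1)}\subset\mathbb{S}^4$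 and $\boldsymbol\omega^{(2)}_{\rm eq}:\mathbb{S}^2\to\mathbb{S}^2_{(2)}\subset\mathbb{S}^4$ are the equatorial embeddings $\boldsymbol\omega^{(1)}_{\rm eq}(x)=(x_3,x_1+ix_2,0)$ and $\boldsymbol\omega^{(2)}_{\rm eq}(x)=(x_3,0,x_1+ix_2)$.
   Context: $\mathbb{S}^4$ is the unit sphere of $\mathbb{R}\oplus\mathbb{C}\oplus\mathbb{C}$, on which $\mathbb{S}^1$ acts by $R_\alpha\cdot(t,\zeta_1,\zeta_2)=(t,e^{i\alpha}\zeta_1,e^{2i\alpha}\zeta_2)$; $\mathbb{S}^1$ acts on $\mathbb{S}^2\subset\mathbb{R}^3$ by rotations $R_\alpha$ of angle $\alpha$ about the $x_3$-axis; a map $\boldsymbol\omega$ is $\mathbb{S}^1$-equivariant if $\boldsymbol\omega(R_\alpha x)=R_\alpha\cdot\boldsymbol\omega(x)$. $\boldsymbol\omega$ is harmonic if it is smooth and $\Delta_T\boldsymbol\omega+|\nabla_T\boldsymbol\omega|^2\boldsymbol\omega=0$ on $\mathbb{S}^2$; it is linearly full if its image spans $\mathbb{R}\oplus\mathbb{C}\oplus\mathbb{C}$ over $\mathbb{R}$. By a theorem of Calabi, the energy $\frac12\int_{\mathbb{S}^2}|\nabla_T\boldsymbol\omega|^2$ of a harmonic sphere in $\mathbb{S}^4$ is an integer multiple of $4\pi$. $S^{(2)}=(0,0,-1)$, $S^{(4)}=(-1,0,0)$. $\mathbb{S}^2_{(1)}$ and $\mathbb{S}^2_{(2)}$ are the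 unit spheres of $\mathbb{R}\oplus\mathbb{C}\oplus\{0\}$ and $\mathbb{R}\oplus\{0\}\oplus\mathbb{C}$, oriented so that the equatorial embeddings have degree one. $\boldsymbol\sigma_2:\mathbb{S}^2\setminus\{S^{(2)}\}\to\mathbb{C}$, $\boldsymbol\sigma_2(x)=\frac{x_1+ix_2}{1+x_3}$, is the stereographic projection from the south pole.
   Formalization: Since the energy fixes d only up to sign (for ω = ω_eq^(1) and d = −1, deg ω = 1 ≠ d), ''deg ω = d'' is read as deg ω = d or deg ω = −d, with deg ω = ±1 (resp. ±2) carrying the same sign as in the formula for ω. *)

(* Defs.v *)
From Stdlib Require Import Reals List ZArith Lra.
From Coquelicot Require Import Coquelicot.
Import ListNotations.
Open Scope R_scope.

(** A map defined on the unit sphere is represented by a total function on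
    [E3] of which only the values on [S2] matter: every definition below
    depends on these values only. *)

Notation E3 := (R * R * R)%type.
Notation E5 := (R * C * C)%type.

Definition S2 (x : E3) : Prop :=
  let '(x1, x2, x3) := x in x1 ^ 2 + x2 ^ 2 + x3 ^ 2 = 1.

Definition S4 (y : E5) : Prop :=
  let '(t, z1, z2) := y in t ^ 2 + Cmod z1 ^ 2 + Cmod z2 ^ 2 = 1.

Definition comp0 (y : E5) : R := fst (fst y).
Definition comp1 (y : E5) : C := snd (fst y).
Definition comp2 (y : E5) : C := snd y.

Definition coordinates : list (E5 -> R) :=
  [comp0; (fun y => Re (comp1 y)); (fun y => Im (comp1 y));
          (fun y => Re (comp2 y)); (fun y => Im (comp2 y))].

Definition sum_list (l : list R) : R := fold_right Rplus 0 l.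

Definition cis (a : R) : C := (cos a, sin a).

Definition rot (a : R) (x : E3) : E3 :=
  let '(x1, x2, x3) := x in
  (cos a * x1 - sin a * x2, sin a * x1 + cos a * x2, x3).

Definition act (a : R) (y : E5) : E5 :=
  let '(t, z1, z2) := y in (t, Cmult (cis a) z1, Cmult (cis (2 * a)) z2).

Definition equivariant (w : E3 -> E5) : Prop :=
  forall (a : R) (x : E3), S2 x -> w (rot a x) = act a (w x).

(** [hext f] is the extension of [f] from the sphere which is homogeneous of
    degree 0.  At points of the sphere, the tangential gradient and the
    Laplace-Beltrami operator of [f] are the Euclidean gradient and Laplacian
    of [hext f]. *)

Definition norm3 (x : E3) : R :=
  let '(x1, x2, x3) := x in sqrt (x1 ^ 2 + x2 ^ 2 + x3 ^ 2).

Definition hext (f : E3 -> R) (x : E3) : R := f (scal (/ norm3 x) x).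

Definition basis3 : list E3 := [(1, 0, 0); (0, 1, 0); (0, 0, 1)].

Definition partial (e : E3) (F : E3 -> R) (x : E3) : R :=
  Derive (fun t : R => F (plus x (scal t e))) 0.

Definition gradT_sq (f : E3 -> R) (x : E3) : R :=
  sum_list (map (fun e => partial e (hext f) x ^ 2) basis3).

Definition LaplT (f : E3 -> R) (x : E3) : R :=
  sum_list (map (fun e => partial e (partial e (hext f)) x) basis3).

(** All iterated partial derivatives of the extension, of any order, are
    (Frechet) differentiable away from the origin. *)
Definition smooth_on_S2 (f : E3 -> R) : Prop :=
  forall es : list E3, incl es basis3 ->
  forall x : E3, x <> zero ->
  ex_filterdiff (fold_right partial (hext f) es) (locally x).

Definition energy_density (w : E3 -> E5) (x : E3) : R :=
  sum_list (map (fun p => gradT_sq (fun y => p (w y)) x) coordinates).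

Definition harmonic (w : E3 -> E5) : Prop :=
  (forall p, In p coordinates -> smooth_on_S2 (fun y => p (w y))) /\
  (forall x, S2 x -> forall p, In p coordinates ->
     LaplT (fun y => p (w y)) x + energy_density w x * p (w x) = 0).

Definition sph (theta phi : R) : E3 :=
  (sin theta * cos phi, sin theta * sin phi, cos theta).

Definition int_S2 (g : E3 -> R) : R :=
  RInt (fun phi =>
    RInt (fun theta => g (sph theta phi) * sin theta) 0 PI) 0 (2 * PI).

Definition energy (w : E3 -> E5) : R := / 2 * int_S2 (energy_density w).

Definition det3 (u v w : E3) : R :=
  let '(u1, u2, u3) := u in
  let '(v1, v2, v3) := v in
  let '(w1, w2, w3) := w in
  u1 * (v2 * w3 - v3 * w2) + u2 * (v3 * w1 - v1 * w3) + u3 * (v1 * w2 - v2 * w1).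

Definition Derive3 (g : R -> E3) (t : R) : E3 :=
  (Derive (fun s => fst (fst (g s))) t,
   Derive (fun s => snd (fst (g s))) t,
   Derive (fun s => snd (g s)) t).

(** Degree of a smooth map [u] from the sphere to itself: [1 / (4 * PI)] times
    the integral of the pull-back by [u] of the area form.  The frame
    (x, d/dtheta, d/dphi) is positively oriented. *)
Definition deg_S2 (u : E3 -> E3) : R :=
  / (4 * PI) *
  RInt (fun phi =>
    RInt (fun theta =>
      det3 (u (sph theta phi))
           (Derive3 (fun s => u (sph s phi)) theta)
           (Derive3 (fun s => u (sph theta s)) phi)) 0 PI) 0 (2 * PI).

(** The spheres [S2_(1)] and [S2_(2)] are identified with [S2] by
    [(t, z) |-> (Re z, Im z, t)], the inverse of the equatorial embedding. *)
Definition deg1 (w : E3 -> E5) : R :=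
  deg_S2 (fun x => (Re (comp1 (w x)), Im (comp1 (w x)), comp0 (w x))).

Definition deg2 (w : E3 -> E5) : R :=
  deg_S2 (fun x => (Re (comp2 (w x)), Im (comp2 (w x)), comp0 (w x))).

Definition nonconstant (w : E3 -> E5) : Prop :=
  ~ exists c : E5, forall x, S2 x -> w x = c.

Definition linearly_full (w : E3 -> E5) : Prop :=
  forall v : E5, exists l : list (R * E3),
    (forall p, In p l -> S2 (snd p)) /\
    v = fold_right (fun p acc => plus (scal (fst p) (w (snd p))) acc) zero l.

Definition pole2 : E3 := (0, 0, -1).
Definition pole4 : E5 := (-1, RtoC 0, RtoC 0).

Definition omega_eq1 (x : E3) : E5 :=
  let '(x1, x2, x3) := x in (x3, (x1, x2) : C, RtoC 0).
Definition omega_eq2 (x : E3) : E5 :=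
  let '(x1, x2, x3) := x in (x3, RtoC 0, (x1, x2) : C).

Definition sigma2 (x : E3) : C :=
  let '(x1, x2, x3) := x in Cdiv (x1, x2) (RtoC (1 + x3)).

Definition sigma2_inv (z : C) : E3 :=
  (2 * Re z / (1 + Cmod z ^ 2),
   2 * Im z / (1 + Cmod z ^ 2),
   (1 - Cmod z ^ 2) / (1 + Cmod z ^ 2)).

Lemma sigma2_inv_S2 z : S2 (sigma2_inv z) /\ sigma2_inv z <> pole2.
Proof.
unfold S2, sigma2_inv, pole2; rewrite Cmod2_alt.
assert (H : 0 < 1 + (Re z ^ 2 + Im z ^ 2)).
{ pose proof (pow2_ge_0 (Re z)); pose proof (pow2_ge_0 (Im z)); lra. }
split; [field; lra|].
intros E; injection E; intros E' _ _.
apply (f_equal (fun t => t * (1 + (Re z ^ 2 + Im z ^ 2)))) in E'.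
unfold Rdiv in E'; rewrite Rmult_assoc, Rinv_l in E'; lra.
Qed.

Lemma sigma2_invK z : sigma2 (sigma2_inv z) = z.
Proof.
destruct z as [a b]; unfold sigma2, sigma2_inv; rewrite Cmod2_alt; simpl Re; simpl Im.
assert (H : 0 < 1 + (a ^ 2 + b ^ 2)).
{ pose proof (pow2_ge_0 a); pose proof (pow2_ge_0 b); lra. }
assert (E : 1 + (1 - (a ^ 2 + b ^ 2)) / (1 + (a ^ 2 + b ^ 2))
            = 2 / (1 + (a ^ 2 + b ^ 2))) by (field; lra).
rewrite E; unfold Cdiv, Cmult, Cinv, RtoC; simpl; f_equal; field; lra.
Qed.

Lemma sigma2K x : S2 x -> x <> pole2 -> sigma2_inv (sigma2 x) = x.
Proof.
destruct x as [[x1 x2] x3]; unfold S2, pole2; intros H N.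
assert (N3 : 1 + x3 <> 0).
{ intros E; apply N.
  assert (x3 = -1) by lra; subst x3.
  pose proof (pow2_ge_0 x1); pose proof (pow2_ge_0 x2).
  rewrite (Rsqr_0_uniq x1), (Rsqr_0_uniq x2); unfold Rsqr; auto; simpl in *; lra. }
unfold sigma2_inv; rewrite Cmod2_alt.
assert (Er : Re (sigma2 (x1, x2, x3)) = x1 / (1 + x3)).
{ unfold sigma2, Cdiv, Cmult, Cinv, RtoC; simpl; field; lra. }
assert (Ei : Im (sigma2 (x1, x2, x3)) = x2 / (1 + x3)).
{ unfold sigma2, Cdiv, Cmult, Cinv, RtoC; simpl; field; lra. }
rewrite Er, Ei.
assert (E : 1 + ((x1 / (1 + x3)) ^ 2 + (x2 / (1 + x3)) ^ 2) = 2 / (1 + x3)).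
{ replace (1 + ((x1 / (1 + x3)) ^ 2 + (x2 / (1 + x3)) ^ 2))
    with (((1 + x3) ^ 2 + (x1 ^ 2 + x2 ^ 2)) / (1 + x3) ^ 2) by (field; lra).
  replace (x1 ^ 2 + x2 ^ 2) with (1 - x3 ^ 2) by lra; field; lra. }
replace (1 - ((x1 / (1 + x3)) ^ 2 + (x2 / (1 + x3)) ^ 2))
  with (2 - 2 / (1 + x3)) by lra.
rewrite E; f_equal; [f_equal|]; field; lra.
Qed.

(** The orientation convention: equatorial embeddings have degree one. *)
Lemma deg_S2_id : deg_S2 (fun x => x) = 1.
Proof.
unfold deg_S2.
rewrite (RInt_ext _ (fun _ => 2)).
- rewrite RInt_const; unfold scal; simpl; unfold mult; simpl.
  field; apply PI_neq0.
- intros phi _.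
  rewrite (RInt_ext _ sin).
  + apply is_RInt_unique.
    replace 2 with (minus (- cos PI) (- cos 0))
      by (rewrite cos_PI, cos_0; unfold minus, plus, opp; simpl; lra).
    apply (is_RInt_derive (fun t => - cos t)).
    * intros t _; auto_derive; [auto|]; simpl; ring.
    * intros t _; apply continuity_pt_filterlim, continuity_sin.
  + intros t _; unfold det3, Derive3, sph; simpl fst; simpl snd.
    assert (D1 : forall c, Derive (fun s => sin s * c) t = cos t * c)
      by (intros c; apply is_derive_unique; auto_derive; auto; ring).
    assert (D2 : Derive cos t = - sin t)
      by (apply is_derive_unique; auto_derive; auto; ring).
    assert (D3 : forall c, Derive (fun s => c * cos s) phi = - (c * sin phi))
      by (intros c; apply is_derive_unique; auto_derive; auto; ring).
    assert (D4 : forall c, Derive (fun s => c * sin s) phi = c * cos phi)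
      by (intros c; apply is_derive_unique; auto_derive; auto; ring).
    rewrite !D1, D3, D4, Derive_const.
    change (fun s : R => cos s) with cos; rewrite D2.
    pose proof (sin2_cos2 phi) as P; pose proof (sin2_cos2 t) as Q.
    unfold Rsqr in P, Q.
    match goal with |- ?a = ?b => change (@eq R a b) end.
    transitivity (sin t * (sin t * sin t + cos t * cos t)
                  * (sin phi * sin phi + cos phi * cos phi)); [ring|].
    rewrite P, Q; ring.
Qed.

Lemma deg1_omega_eq1 : deg1 omega_eq1 = 1.
Proof.
exact deg_S2_id.
Qed.

Lemma deg2_omega_eq2 : deg2 omega_eq2 = 1.
Proof.
exact deg_S2_id.
Qed.

(* Main.v *)
Require Import Defs.
From Stdlib Require Import Reals Lra Lia List ZArith Classical.
From Coquelicot Require Import Coquelicot.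
Open Scope R_scope.

(** The span of the image is invariant under the circle and contains the real axis
    (the image of a pole), so if it is not everything then [w] takes its values in
    [R (+) C] with the circle acting on [C] with weight [k = 1] or [k = 2].  On the
    meridian of colatitude [t] such a map is a pair [(u, v)], and harmonicity becomes a
    system of ordinary differential equations on [(0, PI)].  The Hopf differential vanishes
    at the pole and is constant, which gives [Im (conj v * v') = 0] and
    [(sin t * u')^2 = k^2 (1 - u^2)^2].  The two factors
    [sin t * u' +- k (1 - u^2)] solve linear first order equations, so one of them vanishes
    identically: [sin t * u' = - s k (1 - u^2)] with a constant sign [s].  Then
    [v / (1 + s u)] is a constant multiple of [tan (t / 2) ^ k], which is the stated form in
    stereographic coordinates.  The energy density and the area density are multiples of
    [u'] (up to the factor [sin t]), so both integrals are read off the values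
    [s] and [- s] of [u] at the poles. *)

(** * Extensions of degree zero and equivariance *)

Lemma filterdiff_pair (U V : NormedModule R_AbsRing) (f : R -> U) (g : R -> V)
    (t : R) (lf : R -> U) (lg : R -> V) :
  filterdiff f (locally t) lf -> filterdiff g (locally t) lg ->
  filterdiff (fun s => (f s, g s) : prod_NormedModule R_AbsRing U V) (locally t)
    (fun s => (lf s, lg s)).
Proof.
intros Hf Hg.
apply (filterdiff_comp'_2 f g
  (fun a b => (a, b) : prod_NormedModule R_AbsRing U V) t lf lg (fun a b => (a, b)));
  auto.
apply filterdiff_ext with (f := fun p => p); [intros [a b]; reflexivity|].
apply filterdiff_ext_lin with (l1 := fun p => p); [apply filterdiff_id|].
intros [a b]; reflexivity.
Qed.

Lemma is_derive_linear_curve (F : E3 -> R) (l : E3 -> R) (g1 g2 g3 : R -> R)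
    (t d1 d2 d3 : R) :
  filterdiff F (locally ((g1 t, g2 t, g3 t) : E3)) l ->
  is_derive g1 t d1 -> is_derive g2 t d2 -> is_derive g3 t d3 ->
  is_derive (fun s => F (g1 s, g2 s, g3 s)) t (l (d1, d2, d3)).
Proof.
intros HF H1 H2 H3.
pose proof (filterdiff_pair _ _ _ _ t _ _ (filterdiff_pair _ _ _ _ t _ _ H1 H2) H3) as HG.
pose proof (filterdiff_comp' _ F t _ l HG HF) as HC.
unfold is_derive; eapply filterdiff_ext_lin; [exact HC|].
destruct HF as [Hl _].
intros s; simpl.
rewrite <- (linear_scal l Hl); reflexivity.
Qed.

(** The partial derivatives are the values of the Frechet differential on the basis vectors, so the
    formula is linearity of that differential. It is applied below to dilations, rotations, the
    meridian, the curves [sph] in colatitude, and coordinate lines. *)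
Lemma chain_rule (F : E3 -> R) (g1 g2 g3 : R -> R) (t d1 d2 d3 : R) :
  ex_filterdiff F (locally ((g1 t, g2 t, g3 t) : E3)) ->
  is_derive g1 t d1 -> is_derive g2 t d2 -> is_derive g3 t d3 ->
  is_derive (fun s => F (g1 s, g2 s, g3 s)) t
    (d1 * partial (1, 0, 0) F (g1 t, g2 t, g3 t)
     + d2 * partial (0, 1, 0) F (g1 t, g2 t, g3 t)
     + d3 * partial (0, 0, 1) F (g1 t, g2 t, g3 t)).
Proof.
intros [l HF] H1 H2 H3.
assert (Hp : forall e1 e2 e3,
  partial (e1, e2, e3) F (g1 t, g2 t, g3 t) = l (e1, e2, e3)).
{ intros e1 e2 e3; unfold partial; apply is_derive_unique.
  apply (is_derive_linear_curve F l (fun s => g1 t + s * e1)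
           (fun s => g2 t + s * e2) (fun s => g3 t + s * e3) 0 e1 e2 e3).
  - rewrite !Rmult_0_l, !Rplus_0_r; exact HF.
  - auto_derive; auto; ring.
  - auto_derive; auto; ring.
  - auto_derive; auto; ring. }
rewrite !Hp.
replace (d1 * l (1, 0, 0) + d2 * l (0, 1, 0) + d3 * l (0, 0, 1)) with (l (d1, d2, d3)).
- now apply is_derive_linear_curve.
- destruct HF as [Hl _].
  change (l (d1, d2, d3) = plus (plus (scal d1 (l (1, 0, 0)))
    (scal d2 (l (0, 1, 0)))) (scal d3 (l (0, 0, 1)))).
  rewrite <- !(linear_scal l Hl), <- !(linear_plus l Hl).
  apply f_equal.
  change ((d1, d2, d3) = (d1 * 1 + d2 * 0 + d3 * 0, d1 * 0 + d2 * 1 + d3 * 0,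
    d1 * 0 + d2 * 0 + d3 * 1)).
  apply f_equal2; [apply f_equal2|]; ring.
Qed.

(** The complex function [f + i g] is multiplied by exp (i k a) under the rotation of angle [a]. An
    invariant real function is encoded as [covariant 0 f f]. *)
Definition covariant (k : R) (f g : E3 -> R) : Prop :=
  forall a x, S2 x ->
  f (rot a x) = cos (k * a) * f x - sin (k * a) * g x /\
  g (rot a x) = sin (k * a) * f x + cos (k * a) * g x.

Lemma norm3_pos x : x <> (0, 0, 0) -> 0 < norm3 x.
Proof.
destruct x as [[x1 x2] x3]; intros H; apply sqrt_lt_R0.
pose proof (pow2_ge_0 x1); pose proof (pow2_ge_0 x2); pose proof (pow2_ge_0 x3).
assert (N : x1 ^ 2 + x2 ^ 2 + x3 ^ 2 <> 0); [|lra].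
intros E; apply H; assert (x1 ^ 2 = 0) by lra; assert (x2 ^ 2 = 0) by lra;
  assert (x3 ^ 2 = 0) by lra.
rewrite (Rsqr_0_uniq x1), (Rsqr_0_uniq x2), (Rsqr_0_uniq x3); unfold Rsqr; auto; lra.
Qed.

Lemma normalized_S2 x : x <> (0, 0, 0) -> S2 (scal (/ norm3 x) x).
Proof.
intros H; pose proof (norm3_pos x H) as N.
assert (Q : norm3 x ^ 2 = let '(x1, x2, x3) := x in x1 ^ 2 + x2 ^ 2 + x3 ^ 2).
{ destruct x as [[x1 x2] x3]; unfold norm3; rewrite pow2_sqrt; auto.
  pose proof (pow2_ge_0 x1); pose proof (pow2_ge_0 x2); pose proof (pow2_ge_0 x3); lra. }
destruct x as [[x1 x2] x3]; set (n := norm3 (x1, x2, x3)) in *.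
change ((/ n * x1) ^ 2 + (/ n * x2) ^ 2 + (/ n * x3) ^ 2 = 1).
replace ((/ n * x1) ^ 2 + (/ n * x2) ^ 2 + (/ n * x3) ^ 2)
  with ((x1 ^ 2 + x2 ^ 2 + x3 ^ 2) / n ^ 2) by (field; lra).
rewrite <- Q; field; lra.
Qed.

Lemma hext_S2 f x : S2 x -> hext f x = f x.
Proof.
destruct x as [[x1 x2] x3]; unfold S2, hext, norm3; intros H; rewrite H, sqrt_1, Rinv_1.
f_equal; apply (scal_one (x1, x2, x3 : R)).
Qed.

Lemma hext_scal f c x : 0 < c -> x <> (0, 0, 0) -> hext f (scal c x) = hext f x.
Proof.
intros Hc H; pose proof (norm3_pos x H) as N.
destruct x as [[x1 x2] x3].
assert (E : norm3 (scal c ((x1, x2, x3) : E3)) = c * norm3 (x1, x2, x3)).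
{ unfold norm3.
  change (sqrt ((c * x1) ^ 2 + (c * x2) ^ 2 + (c * x3) ^ 2)
          = c * sqrt (x1 ^ 2 + x2 ^ 2 + x3 ^ 2)).
  rewrite <- (sqrt_pow2 c) at 4 by lra.
  rewrite <- sqrt_mult by (try (pose proof (pow2_ge_0 x1); pose proof (pow2_ge_0 x2);
    pose proof (pow2_ge_0 x3); lra); apply pow2_ge_0).
  f_equal; ring. }
unfold hext; rewrite E, (scal_assoc _ c).
f_equal; f_equal.
change (/ (c * norm3 (x1, x2, x3)) * c = / norm3 (x1, x2, x3)); field; lra.
Qed.

Lemma norm3_rot a x : norm3 (rot a x) = norm3 x.
Proof.
destruct x as [[x1 x2] x3]; unfold norm3, rot; f_equal.
pose proof (sin2_cos2 a) as P; unfold Rsqr in P.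
transitivity ((sin a * sin a + cos a * cos a) * (x1 ^ 2 + x2 ^ 2) + x3 ^ 2);
  [ring | rewrite P; ring].
Qed.

Lemma rot_scal a c x : rot a (scal c x) = scal c (rot a x).
Proof.
destruct x as [[x1 x2] x3].
change ((cos a * (c * x1) - sin a * (c * x2), sin a * (c * x1) + cos a * (c * x2), c * x3)
  = (c * (cos a * x1 - sin a * x2), c * (sin a * x1 + cos a * x2), c * x3)).
f_equal; f_equal; ring.
Qed.

Lemma hext_covariant k f g a x : covariant k f g -> x <> (0, 0, 0) ->
  hext f (rot a x) = cos (k * a) * hext f x - sin (k * a) * hext g x /\
  hext g (rot a x) = sin (k * a) * hext f x + cos (k * a) * hext g x.
Proof.
intros H N; unfold hext; rewrite norm3_rot, <- rot_scal.
now apply H, normalized_S2.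
Qed.

Definition diff_off0 (F : E3 -> R) : Prop :=
  forall x : E3, x <> (0, 0, 0) -> ex_filterdiff F (locally x).

(** An extension of degree zero is constant along the dilations [(1 + t) x]; the left-hand side is
    its derivative there at [t = 0]. *)
Lemma euler_identity f x1 x2 x3 : diff_off0 (hext f) -> (x1, x2, x3) <> (0, 0, 0) ->
  x1 * partial (1, 0, 0) (hext f) (x1, x2, x3)
  + x2 * partial (0, 1, 0) (hext f) (x1, x2, x3)
  + x3 * partial (0, 0, 1) (hext f) (x1, x2, x3) = 0.
Proof.
intros D N.
pose proof (chain_rule (hext f) (fun t => (1 + t) * x1) (fun t => (1 + t) * x2)
  (fun t => (1 + t) * x3) 0 x1 x2 x3) as C; cbv beta in C.
rewrite !Rplus_0_r, !Rmult_1_l in C.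
specialize (C (D _ N)).
assert (C' := C ltac:(auto_derive; auto; ring) ltac:(auto_derive; auto; ring)
  ltac:(auto_derive; auto; ring)); clear C.
apply is_derive_unique in C'; rewrite <- C'.
transitivity (Derive (fun _ : R => hext f (x1, x2, x3)) 0); [|apply Derive_const].
apply Derive_ext_loc.
(* Within distance 1/2 of 0 the factor [1 + t] stays positive, as homogeneity requires. *)
exists (mkposreal (1 / 2) ltac:(lra)); intros t Ht.
change (Rabs (t - 0) < 1 / 2) in Ht; apply Rabs_def2 in Ht.
apply (hext_scal f (1 + t) (x1, x2, x3)); auto; lra.
Qed.

(** Both sides are the derivative at angle 0 along the orbit of the rotation, computed once by the
    chain rule and once from the covariance law. *)
Lemma rotation_identity k f g x1 x2 x3 : covariant k f g ->
  diff_off0 (hext f) -> diff_off0 (hext g) -> (x1, x2, x3) <> (0, 0, 0) ->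
  x1 * partial (0, 1, 0) (hext f) (x1, x2, x3)
  - x2 * partial (1, 0, 0) (hext f) (x1, x2, x3) = - k * hext g (x1, x2, x3) /\
  x1 * partial (0, 1, 0) (hext g) (x1, x2, x3)
  - x2 * partial (1, 0, 0) (hext g) (x1, x2, x3) = k * hext f (x1, x2, x3).
Proof.
intros H Df Dg N.
assert (C : forall h, diff_off0 (hext h) ->
  x1 * partial (0, 1, 0) (hext h) (x1, x2, x3)
  - x2 * partial (1, 0, 0) (hext h) (x1, x2, x3)
  = Derive (fun a => hext h (rot a (x1, x2, x3))) 0).
{ intros h D; symmetry; apply is_derive_unique.
  pose proof (chain_rule (hext h) (fun a => cos a * x1 - sin a * x2)
    (fun a => sin a * x1 + cos a * x2) (fun _ => x3) 0 (- x2) x1 0) as C; cbv beta in C.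
  rewrite cos_0, sin_0 in C.
  replace (1 * x1 - 0 * x2) with x1 in C by ring.
  replace (0 * x1 + 1 * x2) with x2 in C by ring.
  specialize (C (D _ N)).
  evar_last; [apply C|ring]; auto_derive; auto; rewrite ?sin_0, ?cos_0; ring. }
rewrite !C by auto; split; apply is_derive_unique.
- apply is_derive_ext with
    (fun a => cos (k * a) * hext f (x1, x2, x3) - sin (k * a) * hext g (x1, x2, x3)).
  + intros a; symmetry; now apply hext_covariant.
  + auto_derive; auto; rewrite Rmult_0_r, sin_0, cos_0; ring.
- apply is_derive_ext with
    (fun a => sin (k * a) * hext f (x1, x2, x3) + cos (k * a) * hext g (x1, x2, x3)).
  + intros a; symmetry; now apply hext_covariant.
  + auto_derive; auto; rewrite Rmult_0_r, sin_0, cos_0; ring.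
Qed.

Lemma smooth_diff f : smooth_on_S2 f -> diff_off0 (hext f).
Proof.
intros H x N; apply (H nil); auto; intros e [].
Qed.

Lemma smooth_diff_partial f e : smooth_on_S2 f -> In e basis3 ->
  diff_off0 (partial e (hext f)).
Proof.
intros H He x N; apply (H (e :: nil)); auto; intros e' [<-|[]]; auto.
Qed.

(** * Derivatives and Laplacian along a meridian *)

(** The great circle [x2 = 0] by colatitude, with the poles at [t = 0] and [t = PI]. Since [t]
    ranges over the whole line, derivatives at the poles are two-sided. *)
Definition meridian (f : E3 -> R) (t : R) : R := f (sin t, 0, cos t).

Lemma meridian_S2 t : S2 (sin t, 0, cos t).
Proof.
unfold S2; pose proof (sin2_cos2 t) as P; unfold Rsqr in P; lra.
Qed.

Lemma S2_neq0 x : S2 x -> x <> (0, 0, 0).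
Proof.
intros H E; rewrite E in H; unfold S2 in H; lra.
Qed.

Lemma meridian_curve F t : diff_off0 F ->
  is_derive (fun s => F (sin s, 0, cos s)) t
    (cos t * partial (1, 0, 0) F (sin t, 0, cos t)
     - sin t * partial (0, 0, 1) F (sin t, 0, cos t)).
Proof.
intros D.
evar_last.
- apply (chain_rule F sin (fun _ => 0) cos t (cos t) 0 (- sin t)).
  + apply D, S2_neq0, meridian_S2.
  + auto_derive; auto; ring.
  + auto_derive; auto; ring.
  + auto_derive; auto; ring.
- ring.
Qed.

Lemma is_derive_meridian f t : diff_off0 (hext f) ->
  is_derive (meridian f) t
    (cos t * partial (1, 0, 0) (hext f) (sin t, 0, cos t)
     - sin t * partial (0, 0, 1) (hext f) (sin t, 0, cos t)).
Proof.
intros D; apply is_derive_ext with (2 := meridian_curve (hext f) t D).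
intros s; apply hext_S2, meridian_S2.
Qed.

Lemma is_derive_lincomb (a b G H : R -> R) (t da db dG dH : R) :
  is_derive a t da -> is_derive b t db -> is_derive G t dG -> is_derive H t dH ->
  is_derive (fun s => a s * G s + b s * H s) t
    (da * G t + a t * dG + (db * H t + b t * dH)).
Proof.
intros A B DG DH.
apply (is_derive_plus (fun s => a s * G s) (fun s => b s * H s)).
- apply (is_derive_mult a G); auto; exact Rmult_comm.
- apply (is_derive_mult b H); auto; exact Rmult_comm.
Qed.

(** The two orders of mixed partials stay separate: in [LaplT_meridian] each is eliminated by a
    different derivative of Euler's relation. *)
Lemma is_derive2_meridian f t : smooth_on_S2 f ->
  is_derive (Derive (meridian f)) t
    (- sin t * partial (1, 0, 0) (hext f) (sin t, 0, cos t)
     + cos t *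
        (cos t * partial (1, 0, 0) (partial (1, 0, 0) (hext f)) (sin t, 0, cos t)
         - sin t * partial (0, 0, 1) (partial (1, 0, 0) (hext f)) (sin t, 0, cos t))
     - cos t * partial (0, 0, 1) (hext f) (sin t, 0, cos t)
     - sin t *
        (cos t * partial (1, 0, 0) (partial (0, 0, 1) (hext f)) (sin t, 0, cos t)
         - sin t * partial (0, 0, 1) (partial (0, 0, 1) (hext f)) (sin t, 0, cos t))).
Proof.
intros H.
apply is_derive_ext with (fun s =>
  cos s * partial (1, 0, 0) (hext f) (sin s, 0, cos s)
     + - sin s * partial (0, 0, 1) (hext f) (sin s, 0, cos s)).
{ intros s; symmetry; apply is_derive_unique.
  evar_last; [apply is_derive_meridian, smooth_diff, H|ring]. }
pose proof (meridian_curve _ t (smooth_diff_partial f (1, 0, 0) H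
  ltac:(simpl; auto))) as D1.
pose proof (meridian_curve _ t (smooth_diff_partial f (0, 0, 1) H
  ltac:(simpl; auto))) as D3.
evar_last.
- apply is_derive_lincomb with (3 := D1) (4 := D3).
  + apply is_derive_cos.
  + auto_derive; auto.
- simpl; ring.
Qed.

Lemma is_derive_axis1 F x1 x2 x3 : diff_off0 F -> (x1, x2, x3) <> (0, 0, 0) ->
  is_derive (fun s => F (x1 + s, x2, x3)) 0 (partial (1, 0, 0) F (x1, x2, x3)).
Proof.
intros D N; pose proof (chain_rule F (fun s => x1 + s) (fun _ => x2) (fun _ => x3)
  0 1 0 0) as C; cbv beta in C; rewrite Rplus_0_r in C.
evar_last; [apply C|ring]; auto; auto_derive; auto; ring.
Qed.

Lemma is_derive_axis2 F x1 x2 x3 : diff_off0 F -> (x1, x2, x3) <> (0, 0, 0) ->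
  is_derive (fun s => F (x1, x2 + s, x3)) 0 (partial (0, 1, 0) F (x1, x2, x3)).
Proof.
intros D N; pose proof (chain_rule F (fun _ => x1) (fun s => x2 + s) (fun _ => x3)
  0 0 1 0) as C; cbv beta in C; rewrite Rplus_0_r in C.
evar_last; [apply C|ring]; auto; auto_derive; auto; ring.
Qed.

Lemma is_derive_axis3 F x1 x2 x3 : diff_off0 F -> (x1, x2, x3) <> (0, 0, 0) ->
  is_derive (fun s => F (x1, x2, x3 + s)) 0 (partial (0, 0, 1) F (x1, x2, x3)).
Proof.
intros D N; pose proof (chain_rule F (fun _ => x1) (fun _ => x2) (fun s => x3 + s)
  0 0 0 1) as C; cbv beta in C; rewrite Rplus_0_r in C.
evar_last; [apply C|ring]; auto; auto_derive; auto; ring.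
Qed.

(** Derivatives of Euler's relation account for the radial direction. The second derivative across
    the meridian comes from the rotation identities: the one for [f], differentiated once, brings in
    [g], and the one for [g] returns to [f], whence the term in [k ^ 2]. *)
Lemma LaplT_meridian k f g t : covariant k f g -> smooth_on_S2 f -> smooth_on_S2 g ->
  sin t <> 0 ->
  LaplT f (sin t, 0, cos t) =
    Derive (Derive (meridian f)) t + cos t / sin t * Derive (meridian f) t
    - k ^ 2 * meridian f t / sin t ^ 2.
Proof.
intros H Sf Sg S0.
pose proof (smooth_diff f Sf) as Df; pose proof (smooth_diff g Sg) as Dg.
pose proof (smooth_diff_partial f (1, 0, 0) Sf ltac:(simpl; auto)) as Df1.
pose proof (smooth_diff_partial f (0, 1, 0) Sf ltac:(simpl; auto)) as Df2.
pose proof (smooth_diff_partial f (0, 0, 1) Sf ltac:(simpl; auto)) as Df3.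
set (x := (sin t, 0, cos t) : E3).
assert (N : forall a b, (sin t, a, b) <> (0, 0, 0))
  by (intros a b E; injection E; auto).
rewrite (is_derive_unique _ _ _ (is_derive2_meridian f t Sf)).
rewrite (is_derive_unique _ _ _ (is_derive_meridian f t Df)).
unfold meridian at 1; rewrite <- (hext_S2 f) by apply meridian_S2.
unfold LaplT, basis3, sum_list; simpl; fold x.
pose proof (euler_identity f (sin t) 0 (cos t) Df (N _ _)) as E0; fold x in E0.
destruct (rotation_identity k f g (sin t) 0 (cos t) H Df Dg (N _ _)) as [_ R0];
  fold x in R0.
(* The Euler and rotation identities, differentiated along the axes. *)
assert (E1 : partial (1, 0, 0) (hext f) x
  + sin t * partial (1, 0, 0) (partial (1, 0, 0) (hext f)) x
  + cos t * partial (1, 0, 0) (partial (0, 0, 1) (hext f)) x = 0).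
{ pose proof (is_derive_axis1 _ (sin t) 0 (cos t) Df1 (N _ _)) as A1.
  pose proof (is_derive_axis1 _ (sin t) 0 (cos t) Df3 (N _ _)) as A3.
  transitivity (Derive (fun s =>
    (sin t + s) * partial (1, 0, 0) (hext f) (sin t + s, 0, cos t)
    + cos t * partial (0, 0, 1) (hext f) (sin t + s, 0, cos t)) 0).
  - symmetry; apply is_derive_unique; evar_last.
    + apply is_derive_lincomb with (3 := A1) (4 := A3); auto_derive; auto.
    + rewrite !Rplus_0_r; fold x; ring.
  - transitivity (Derive (fun _ : R => 0) 0); [|apply Derive_const].
    apply Derive_ext_loc.
    (* This radius keeps [sin t + s] nonzero, hence the shifted point away from the origin. *)
    exists (mkposreal (Rabs (sin t)) (Rabs_pos_lt _ S0)); intros s Hs.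
    change (Rabs (s - 0) < Rabs (sin t)) in Hs; rewrite Rminus_0_r in Hs.
    etransitivity; [|apply (euler_identity f (sin t + s) 0 (cos t) Df)]; [ring|].
    intros E; injection E; intros _ E'.
    replace s with (- sin t) in Hs by lra; rewrite Rabs_Ropp in Hs; lra. }
assert (E3 : sin t * partial (0, 0, 1) (partial (1, 0, 0) (hext f)) x
  + partial (0, 0, 1) (hext f) x
  + cos t * partial (0, 0, 1) (partial (0, 0, 1) (hext f)) x = 0).
{ pose proof (is_derive_axis3 _ (sin t) 0 (cos t) Df1 (N _ _)) as A1.
  pose proof (is_derive_axis3 _ (sin t) 0 (cos t) Df3 (N _ _)) as A3.
  transitivity (Derive (fun s =>
    sin t * partial (1, 0, 0) (hext f) (sin t, 0, cos t + s)
    + (cos t + s) * partial (0, 0, 1) (hext f) (sin t, 0, cos t + s)) 0).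
  - symmetry; apply is_derive_unique; evar_last.
    + apply is_derive_lincomb with (3 := A1) (4 := A3); auto_derive; auto.
    + rewrite !Rplus_0_r; fold x; ring.
  - transitivity (Derive (fun _ : R => 0) 0); [|apply Derive_const].
    apply Derive_ext; intros s.
    etransitivity; [|apply (euler_identity f (sin t) 0 (cos t + s) Df), N]; ring. }
assert (R2 : - partial (1, 0, 0) (hext f) x
  + sin t * partial (0, 1, 0) (partial (0, 1, 0) (hext f)) x
  = - k * partial (0, 1, 0) (hext g) x).
{ pose proof (is_derive_axis2 _ (sin t) 0 (cos t) Df1 (N _ _)) as A1.
  pose proof (is_derive_axis2 _ (sin t) 0 (cos t) Df2 (N _ _)) as A2.
  pose proof (is_derive_axis2 _ (sin t) 0 (cos t) Dg (N _ _)) as Ag.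
  transitivity (Derive (fun s =>
    sin t * partial (0, 1, 0) (hext f) (sin t, 0 + s, cos t)
    + - (0 + s) * partial (1, 0, 0) (hext f) (sin t, 0 + s, cos t)) 0).
  - symmetry; apply is_derive_unique; evar_last.
    + apply is_derive_lincomb with (3 := A2) (4 := A1); auto_derive; auto.
    + rewrite !Rplus_0_r; fold x; ring.
  - transitivity (Derive (fun s => - k * hext g (sin t, 0 + s, cos t)) 0).
    + apply Derive_ext; intros s.
      etransitivity;
        [|apply (proj1 (rotation_identity k f g (sin t) (0 + s) (cos t) H Df Dg (N _ _)))].
      ring.
    + rewrite Derive_scal; f_equal; apply is_derive_unique, Ag. }
change (sin t, 0, cos t) with x.
set (F1 := partial (1, 0, 0) (hext f) x) in *.
set (F3 := partial (0, 0, 1) (hext f) x) in *.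
set (F11 := partial (1, 0, 0) (partial (1, 0, 0) (hext f)) x) in *.
set (F22 := partial (0, 1, 0) (partial (0, 1, 0) (hext f)) x) in *.
set (F33 := partial (0, 0, 1) (partial (0, 0, 1) (hext f)) x) in *.
set (F13 := partial (1, 0, 0) (partial (0, 0, 1) (hext f)) x) in *.
set (F31 := partial (0, 0, 1) (partial (1, 0, 0) (hext f)) x) in *.
set (G2 := partial (0, 1, 0) (hext g) x) in *.
pose proof (sin2_cos2 t) as P; unfold Rsqr in P.
set (s := sin t) in *; set (c := cos t) in *.
assert (G2e : G2 = k * hext f x / s) by (apply (Rmult_eq_reg_l s); auto; field_simplify; lra).
assert (F22e : F22 = (F1 - k * G2) / s)
  by (apply (Rmult_eq_reg_l s); auto; field_simplify; lra).
rewrite F22e, G2e.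
(* The radial derivative vanishes, so the first partial is [cos t] times the derivative along the
   meridian; this produces the cotangent term. *)
assert (F1e : F1 = c * (c * F1 - s * F3)).
{ replace (c * (c * F1 - s * F3))
    with ((s * s + c * c) * F1 - s * (s * F1 + 0 * 0 + c * F3)) by ring.
  rewrite P; replace (s * F1 + 0 * 0 + c * F3) with 0 by lra; ring. }
assert (L : - s * F1 + c * (c * F11 - s * F31) - c * F3 - s * (c * F13 - s * F33)
  = F11 + F33).
{ transitivity ((s * s + c * c) * (F11 + F33) - s * (F1 + s * F11 + c * F13)
    - c * (s * F31 + F3 + c * F33)); [ring|].
  rewrite P, E1, E3; ring. }
rewrite L.
replace (c / s * (c * F1 - s * F3)) with (F1 / s) by (rewrite F1e at 1; field; auto).
field; auto.
Qed.

(** * The equations along a meridian *)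

(** Here and in [derive_zero_eq] the value of the derivative is constrained only inside the
    interval, so that equations valid off the poles can be integrated up to the poles. *)
Lemma derive_nonneg_le (f df : R -> R) (a b : R) : a <= b ->
  (forall t, a <= t <= b -> is_derive f t (df t)) ->
  (forall t, a < t < b -> 0 <= df t) -> f a <= f b.
Proof.
intros [ab| ->] D P; [|lra].
destruct (MVT_cor2 f df a b ab) as [c [E C]].
- intros c C; now apply is_derive_Reals, D.
- specialize (P c C); pose proof (Rmult_le_pos _ (b - a) P ltac:(lra)); lra.
Qed.

Lemma derive_zero_eq (f df : R -> R) (a b : R) : a <= b ->
  (forall t, a <= t <= b -> is_derive f t (df t)) ->
  (forall t, a < t < b -> df t = 0) -> f a = f b.
Proof.
intros [ab| ->] D P; [|auto].
destruct (MVT_cor2 f df a b ab) as [c [E C]].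
- intros c C; now apply is_derive_Reals, D.
- rewrite (P c C) in E; lra.
Qed.

Ltac eta_Derive := repeat match goal with
  | |- context [Derive (fun x => ?f x) ?t] =>
      progress change (Derive (fun x => f x) t) with (Derive f t) end.

(** This is tan (t / 2), the modulus of the stereographic coordinate at colatitude [t]. *)
Definition tan_half (t : R) : R := sin t / (1 + cos t).

(** A primitive of [/ sin t] on the open interval: in this variable, [sin t] times the derivative in
    [t] becomes plain differentiation. *)
Definition ln_tan_half (t : R) : R := ln (tan_half t).

Lemma cos_gt_m1 t : 0 <= t < PI -> 0 < 1 + cos t.
Proof.
intros H; assert (cos PI < cos t) by (apply cos_decreasing_1; lra).
rewrite cos_PI in *; lra.
Qed.

Lemma tan_half_pos t : 0 < t < PI -> 0 < tan_half t.
Proof.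
intros H; apply Rdiv_lt_0_compat; [now apply sin_gt_0|apply cos_gt_m1; lra].
Qed.

Lemma is_derive_ln_tan_half t : 0 < t < PI ->
  is_derive ln_tan_half t (/ sin t).
Proof.
intros H; pose proof (sin_gt_0 t (proj1 H) (proj2 H)) as S.
pose proof (cos_gt_m1 t ltac:(lra)) as C.
pose proof (sin2_cos2 t) as P; unfold Rsqr in P.
unfold ln_tan_half, tan_half; auto_derive.
- repeat split; try lra.
  apply (tan_half_pos t H).
- field_simplify_eq; lra.
Qed.

(** The weights [exp (2 e M ln_tan_half t)], [e = 1, -1], absorb the
    coefficient [c], so that [y ^ 2] times the weight is monotone. *)
Lemma linear_ode_zero (M : R) (c y dy : R -> R) :
  (forall t, 0 < t < PI -> is_derive y t (dy t)) ->
  (forall t, 0 < t < PI -> sin t * dy t = c t * y t) ->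
  (forall t, 0 < t < PI -> Rabs (c t) <= M) ->
  forall t0, 0 < t0 < PI -> y t0 = 0 -> forall t, 0 < t < PI -> y t = 0.
Proof.
intros D E B t0 H0 Y0.
assert (W : forall e t, 0 < t < PI -> is_derive
  (fun x => y x ^ 2 * exp (2 * e * M * ln_tan_half x)) t
  (2 / sin t * exp (2 * e * M * ln_tan_half t) * y t ^ 2 * (c t + e * M))).
{ intros e t Ht; pose proof (sin_gt_0 t (proj1 Ht) (proj2 Ht)) as S.
  pose proof (is_derive_ln_tan_half t Ht) as DL.
  pose proof (D t Ht) as Dy.
  auto_derive.
  - repeat apply conj; [now exists (dy t)|now exists (/ sin t)|exact I].
  - eta_Derive; replace (Derive y t) with (dy t)
      by (symmetry; now apply is_derive_unique).
    replace (Derive ln_tan_half t) with (/ sin t)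
      by (symmetry; now apply is_derive_unique).
    replace (dy t) with (c t * y t / sin t) by (rewrite <- E by auto; field; lra).
    field; lra. }
assert (Z : forall e t, y t ^ 2 * exp (2 * e * M * ln_tan_half t) = 0 -> y t = 0).
{ intros e t Q; apply Rmult_integral in Q as [Q|Q].
  - apply Rsqr_0_uniq; unfold Rsqr; lra.
  - pose proof (exp_pos (2 * e * M * ln_tan_half t)); lra. }
assert (N : forall e t, 0 <= y t ^ 2 * exp (2 * e * M * ln_tan_half t)).
{ intros e t; apply Rmult_le_pos; [apply pow2_ge_0|apply Rlt_le, exp_pos]. }
assert (P : forall e t, 0 < t < PI ->
  0 <= 2 / sin t * exp (2 * e * M * ln_tan_half t) * y t ^ 2).
{ intros e t Ht; apply Rmult_le_pos; [|apply pow2_ge_0].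
  apply Rmult_le_pos; [|apply Rlt_le, exp_pos].
  apply Rlt_le, Rdiv_lt_0_compat; [lra|now apply sin_gt_0]. }
(* With [e = 1] the weighted square is nondecreasing, so its zero at [t0] spreads to the left; with
   [e = -1] it is nonincreasing, and the zero spreads to the right. *)
intros t Ht; destruct (Rle_dec t t0) as [L|L].
- apply (Z 1), Rle_antisym; [|apply N].
  replace 0 with (y t0 ^ 2 * exp (2 * 1 * M * ln_tan_half t0)) by (rewrite Y0; ring).
  refine (derive_nonneg_le _ _ t t0 L (fun x Hx => W 1 x _) _); [lra|].
  intros x Hx; apply Rmult_le_pos; [apply P; lra|].
  pose proof (B x ltac:(lra)) as Bx; apply Rabs_le_between in Bx; lra.
- apply (Z (-1)), Rle_antisym; [|apply N].
  apply Ropp_le_cancel.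
  replace (- 0) with (- (y t0 ^ 2 * exp (2 * -1 * M * ln_tan_half t0)))
    by (rewrite Y0; ring).
  refine (derive_nonneg_le (fun x => - (y x ^ 2 * exp (2 * -1 * M * ln_tan_half x)))
    _ t0 t ltac:(lra) (fun x Hx => is_derive_opp _ _ _ (W (-1) x _)) _); [lra|].
  intros x Hx.
  pose proof (B x ltac:(lra)) as Bx; apply Rabs_le_between in Bx.
  change (0 <= - (2 / sin x * exp (2 * -1 * M * ln_tan_half x) * y x ^ 2
    * (c x + -1 * M))).
  rewrite Ropp_mult_distr_r; apply Rmult_le_pos; [apply P|]; lra.
Qed.

(** An equivariant harmonic map into the sphere of [R (+) C], the rotation acting on [C]
    with weight [k], along the meridian: real component [u] and complex
    component [(a, b)].  The energy density is eliminated from the equations. *)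
Record harmonic_profile (k : R) (u a b : R -> R) : Prop := {
  hp_u1 : forall t, ex_derive u t;
  hp_a1 : forall t, ex_derive a t;
  hp_b1 : forall t, ex_derive b t;
  hp_u2 : forall t, ex_derive (Derive u) t;
  hp_a2 : forall t, ex_derive (Derive a) t;
  hp_b2 : forall t, ex_derive (Derive b) t;
  hp_sphere : forall t, u t ^ 2 + a t ^ 2 + b t ^ 2 = 1;
  hp_pole_a : a 0 = 0;
  hp_pole_b : b 0 = 0;
  hp_pole_PI : u PI ^ 2 = 1;
  hp_eq : forall t, 0 < t < PI ->
    let E := sin t ^ 2 * (Derive u t ^ 2 + Derive a t ^ 2 + Derive b t ^ 2)
             + k ^ 2 * (a t ^ 2 + b t ^ 2) in
    sin t ^ 2 * Derive (Derive u) t + sin t * cos t * Derive u t + E * u t = 0 /\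
    sin t ^ 2 * Derive (Derive a) t + sin t * cos t * Derive a t
      - k ^ 2 * a t + E * a t = 0 /\
    sin t ^ 2 * Derive (Derive b) t + sin t * cos t * Derive b t
      - k ^ 2 * b t + E * b t = 0
}.

Lemma profile_orthogonal k u a b t : harmonic_profile k u a b ->
  u t * Derive u t + a t * Derive a t + b t * Derive b t = 0.
Proof.
intros H.
assert (D : Derive (fun x => u x ^ 2 + a x ^ 2 + b x ^ 2) t = 0).
{ rewrite (Derive_ext _ (fun _ => 1)); [apply Derive_const|apply H]. }
assert (D' : is_derive (fun x => u x ^ 2 + a x ^ 2 + b x ^ 2) t
  (2 * (u t * Derive u t + a t * Derive a t + b t * Derive b t))).
{ auto_derive.
  - repeat split; apply H.
  - eta_Derive; ring. }
apply is_derive_unique in D'; pose proof (eq_trans (eq_sym D) D'); lra.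
Qed.

(* The real part of the Hopf differential is constant in [t], and vanishes at the pole. *)
Lemma profile_hopf_re k u a b t : harmonic_profile k u a b -> 0 <= t <= PI ->
  sin t ^ 2 * (Derive u t ^ 2 + Derive a t ^ 2 + Derive b t ^ 2)
  = k ^ 2 * (a t ^ 2 + b t ^ 2).
Proof.
intros H Ht.
apply Rminus_diag_uniq.
set (h := fun t => sin t ^ 2 * (Derive u t ^ 2 + Derive a t ^ 2 + Derive b t ^ 2)
  - k ^ 2 * (a t ^ 2 + b t ^ 2)).
change (h t = 0).
replace 0 with (h 0) by (unfold h; rewrite sin_0, (hp_pole_a _ _ _ _ H),
  (hp_pole_b _ _ _ _ H); ring).
symmetry.
apply derive_zero_eq with (df := fun t =>
  2 * sin t * cos t * (Derive u t ^ 2 + Derive a t ^ 2 + Derive b t ^ 2)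
  + 2 * sin t ^ 2 * (Derive u t * Derive (Derive u) t + Derive a t * Derive (Derive a) t
     + Derive b t * Derive (Derive b) t)
  - 2 * k ^ 2 * (a t * Derive a t + b t * Derive b t)); [lra| |].
- intros x _; unfold h; auto_derive.
  + repeat split; apply H.
  + eta_Derive; ring.
- intros x Hx; destruct (hp_eq _ _ _ _ H x ltac:(lra)) as [Eu [Ea Eb]].
  pose proof (profile_orthogonal k u a b x H) as O.
  set (E := sin x ^ 2 * (Derive u x ^ 2 + Derive a x ^ 2 + Derive b x ^ 2)
             + k ^ 2 * (a x ^ 2 + b x ^ 2)) in *.
  (* The three equations are paired with [2 u'], [2 a'], [2 b']; the terms in [E] cancel because the
     velocity is orthogonal to the position. *)
  transitivity (2 * Derive u x *
      (sin x ^ 2 * Derive (Derive u) x + sin x * cos x * Derive u x + E * u x)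
    + 2 * Derive a x * (sin x ^ 2 * Derive (Derive a) x + sin x * cos x * Derive a x
      - k ^ 2 * a x + E * a x)
    + 2 * Derive b x * (sin x ^ 2 * Derive (Derive b) x + sin x * cos x * Derive b x
      - k ^ 2 * b x + E * b x)
    - 2 * E * (u x * Derive u x + a x * Derive a x + b x * Derive b x)); [ring|].
  rewrite Eu, Ea, Eb, O; ring.
Qed.

(** Regarding [E] as a coefficient, [a] and [b] solve the same linear equation, so [sin t] times
    their Wronskian is constant, and it vanishes at [t = 0]. *)
Lemma profile_hopf_im k u a b t : harmonic_profile k u a b -> 0 < t < PI ->
  a t * Derive b t - b t * Derive a t = 0.
Proof.
intros H Ht; pose proof (sin_gt_0 t (proj1 Ht) (proj2 Ht)) as S.
apply (Rmult_eq_reg_l (sin t)); [rewrite Rmult_0_r|lra].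
set (h := fun t => sin t * (a t * Derive b t - b t * Derive a t)).
change (h t = 0).
replace 0 with (h 0) by (unfold h; rewrite sin_0; ring).
symmetry.
apply derive_zero_eq with (df := fun t =>
  cos t * (a t * Derive b t - b t * Derive a t)
  + sin t * (a t * Derive (Derive b) t - b t * Derive (Derive a) t)); [lra| |].
- intros x _; unfold h; auto_derive.
  + repeat split; apply H.
  + eta_Derive; ring.
- intros x Hx; destruct (hp_eq _ _ _ _ H x ltac:(lra)) as [_ [Ea Eb]].
  assert (Sx : 0 < sin x) by (apply sin_gt_0; lra).
  apply (Rmult_eq_reg_l (sin x)); [rewrite Rmult_0_r|lra].
  set (E := sin x ^ 2 * (Derive u x ^ 2 + Derive a x ^ 2 + Derive b x ^ 2)
             + k ^ 2 * (a x ^ 2 + b x ^ 2)) in *.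
  transitivity (a x * (sin x ^ 2 * Derive (Derive b) x + sin x * cos x * Derive b x
      - k ^ 2 * b x + E * b x)
    - b x * (sin x ^ 2 * Derive (Derive a) x + sin x * cos x * Derive a x
      - k ^ 2 * a x + E * a x)); [ring|].
  rewrite Ea, Eb; ring.
Qed.

Lemma profile_u_bound k u a b t : harmonic_profile k u a b -> -1 <= u t <= 1.
Proof.
intros H; pose proof (hp_sphere _ _ _ _ H t) as S.
pose proof (pow2_ge_0 (a t)); pose proof (pow2_ge_0 (b t)); nra.
Qed.

(** Multiplying the real Hopf relation by [a^2 + b^2 = 1 - u^2] allows [a'] and [b'] to be
    eliminated; what remains is a difference of squares in [u] alone. *)
Lemma profile_first_integral k u a b t : harmonic_profile k u a b -> 0 < t < PI ->
  (sin t * Derive u t - k * (1 - u t ^ 2)) * (sin t * Derive u t + k * (1 - u t ^ 2)) = 0.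
Proof.
intros H Ht.
pose proof (profile_hopf_re k u a b t H ltac:(lra)) as Hr.
pose proof (profile_hopf_im k u a b t H Ht) as Hi.
pose proof (profile_orthogonal k u a b t H) as O.
pose proof (hp_sphere _ _ _ _ H t) as S.
set (p := Derive u t) in *; set (q := Derive a t) in *; set (r := Derive b t) in *.
(* Lagrange's identity: [(a^2+b^2)(a'^2+b'^2) = (aa'+bb')^2 + (ab'-ba')^2]. *)
assert (L : (a t ^ 2 + b t ^ 2) * (q ^ 2 + r ^ 2) = (u t * p) ^ 2).
{ transitivity ((a t * q + b t * r) ^ 2 + (a t * r - b t * q) ^ 2); [ring|].
  rewrite Hi; replace (a t * q + b t * r) with (- (u t * p)) by lra; ring. }
replace (1 - u t ^ 2) with (a t ^ 2 + b t ^ 2) by lra.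
set (v := a t ^ 2 + b t ^ 2) in *.
transitivity (sin t ^ 2 * p ^ 2 - v * (k ^ 2 * v)); [ring|].
rewrite <- Hr.
replace (v * (sin t ^ 2 * (p ^ 2 + q ^ 2 + r ^ 2)))
  with (sin t ^ 2 * (v * p ^ 2 + v * (q ^ 2 + r ^ 2))) by ring.
rewrite L; replace v with (1 - u t ^ 2) by (unfold v; lra); ring.
Qed.

(* Each factor of the first integral solves a linear equation, so one of them vanishes
   identically. *)
Lemma profile_first_order k u a b : 0 < k -> harmonic_profile k u a b ->
  exists s, (s = 1 \/ s = -1) /\
  forall t, 0 < t < PI -> sin t * Derive u t = - s * k * (1 - u t ^ 2).
Proof.
intros Hk H.
(* The real Hopf relation turns the energy term into [2 k^2 (1 - u^2) u]. Hence each factor [y]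
   satisfies [sin t * y' = - 2 e k u * y], with coefficient bounded by [2 * k]. *)
assert (Z : forall e, e ^ 2 = 1 -> forall t0, 0 < t0 < PI ->
  sin t0 * Derive u t0 + e * k * (1 - u t0 ^ 2) = 0 ->
  forall t, 0 < t < PI -> sin t * Derive u t + e * k * (1 - u t ^ 2) = 0).
{ intros e He.
  apply linear_ode_zero with (M := 2 * k) (c := fun t => - 2 * e * k * u t)
    (y := fun t => sin t * Derive u t + e * k * (1 - u t ^ 2))
    (dy := fun t => cos t * Derive u t + sin t * Derive (Derive u) t
      - 2 * e * k * u t * Derive u t).
  - intros t Ht; auto_derive.
    + repeat split; apply H.
    + eta_Derive; ring.
  - intros t Ht; destruct (hp_eq _ _ _ _ H t Ht) as [Eu _].
    rewrite (profile_hopf_re k u a b t H) in Eu by lra.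
    replace (a t ^ 2 + b t ^ 2) with (1 - u t ^ 2) in Eu
      by (pose proof (hp_sphere _ _ _ _ H t); lra).
    transitivity (- (k ^ 2 * (1 - u t ^ 2) + k ^ 2 * (1 - u t ^ 2)) * u t
      - 2 * e * k * u t * (sin t * Derive u t)); [lra|].
    transitivity (- 2 * (e ^ 2) * k ^ 2 * (1 - u t ^ 2) * u t
      - 2 * e * k * u t * (sin t * Derive u t)); [rewrite He|]; ring.
  - intros t Ht; pose proof (profile_u_bound k u a b t H).
    assert (e = 1 \/ e = -1) as [-> | ->] by (assert ((e - 1) * (e + 1) = 0) by lra;
      apply Rmult_integral in H1 as [?|?]; [left|right]; lra);
      apply Rabs_le; nra. }
assert (HP : 0 < PI / 2 < PI) by (pose proof PI_RGT_0; lra).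
(* The factor that vanishes at the equator vanishes everywhere by [Z], which fixes the sign [s]
   independently of [t]. *)
destruct (Rmult_integral _ _ (profile_first_integral k u a b (PI / 2) H HP)) as [Q|Q].
- exists (-1); split; auto; intros t Ht.
  pose proof (Z (-1) ltac:(ring) (PI / 2) HP ltac:(lra) t Ht); lra.
- exists 1; split; auto; intros t Ht.
  pose proof (Z 1 ltac:(ring) (PI / 2) HP ltac:(lra) t Ht); lra.
Qed.

(** The function [s * u] is nonincreasing and is 1 or -1 at each pole. Either it keeps its value and
    the profile is constant, or it runs from 1 to -1; then [a] and [b] solve one first order linear
    equation, with explicit solutions. *)
Lemma profile_classification k u a b : 0 < k -> harmonic_profile k u a b ->
  (forall t, 0 <= t <= PI -> u t = u 0 /\ a t = 0 /\ b t = 0) \/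
  exists s m1 m2, (s = 1 \/ s = -1) /\ (m1 <> 0 \/ m2 <> 0) /\
    u 0 = s /\ u PI = - s /\
    forall t, 0 < t < PI ->
      0 < 1 + s * u t /\
      sin t * Derive u t = - s * k * (1 - u t ^ 2) /\
      a t = s * (1 + s * u t) * m1 * Rpower (tan_half t) k /\
      b t = s * (1 + s * u t) * m2 * Rpower (tan_half t) k.
Proof.
intros Hk H; pose proof PI_RGT_0 as HPI.
destruct (profile_first_order k u a b Hk H) as [s [Hs U]].
assert (s2 : s ^ 2 = 1) by (destruct Hs as [-> | ->]; ring).
assert (B : forall t, -1 <= s * u t <= 1)
  by (intros t; pose proof (profile_u_bound k u a b t H); destruct Hs as [-> | ->]; lra).
assert (u0 : u 0 ^ 2 = 1).
{ pose proof (hp_sphere _ _ _ _ H 0) as S; rewrite (hp_pole_a _ _ _ _ H),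
    (hp_pole_b _ _ _ _ H) in S; lra. }
assert (Du : forall e t, is_derive (fun t => 1 + e * u t) t (e * Derive u t)).
{ intros e t; auto_derive; [apply H|eta_Derive; ring]. }
assert (Dnu : forall t, 0 < t < PI -> s * Derive u t <= 0).
{ intros t Ht; pose proof (sin_gt_0 t (proj1 Ht) (proj2 Ht)) as St.
  apply (Rmult_le_reg_l (sin t)); auto.
  replace (sin t * (s * Derive u t)) with (s * (sin t * Derive u t)) by ring.
  rewrite U by auto.
  replace (s * (- s * k * (1 - u t ^ 2))) with (- (s ^ 2) * (k * (1 - u t ^ 2))) by ring.
  rewrite s2; pose proof (profile_u_bound k u a b t H).
  assert (0 <= k * (1 - u t ^ 2)) by (apply Rmult_le_pos; nra); lra. }
assert (Mon : forall x y, 0 <= x -> x <= y -> y <= PI -> s * u y <= s * u x).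
{ intros x y X XY Y.
  pose proof (derive_nonneg_le (fun t => 1 + - s * u t) _ x y XY (fun t _ => Du (- s) t)) as L.
  cbv beta in L; assert (1 + - s * u x <= 1 + - s * u y); [apply L|lra].
  intros t Ht; pose proof (Dnu t ltac:(lra)); lra. }
(* If [u] stays at its polar value, then [u^2 = 1] throughout and the sphere constraint leaves
   nothing for [a] and [b]. *)
assert (Cst : (forall t, 0 <= t <= PI -> s * u t = s * u 0) ->
  forall t, 0 <= t <= PI -> u t = u 0 /\ a t = 0 /\ b t = 0).
{ intros Q t Ht; assert (E : u t = u 0).
  { rewrite <- (Rmult_1_l (u t)), <- (Rmult_1_l (u 0)), <- s2.
    replace (s ^ 2 * u t) with (s * (s * u t)) by ring; rewrite Q by auto; ring. }
  pose proof (hp_sphere _ _ _ _ H t) as S; rewrite E, u0 in S.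
  pose proof (pow2_ge_0 (a t)); pose proof (pow2_ge_0 (b t)).
  repeat split; auto; apply Rsqr_0_uniq; unfold Rsqr; lra. }
assert (PM : forall x, x ^ 2 = 1 -> s * x = 1 \/ s * x = -1).
{ intros x X; assert (x = 1 \/ x = -1) as [-> | ->] by
    (assert (Q : (x - 1) * (x + 1) = 0) by lra;
     apply Rmult_integral in Q as [?|?]; [left|right]; lra);
  destruct Hs as [-> | ->]; lra. }
(* Starting at the minimum -1, or ending at the maximum 1, forces a nonincreasing [s * u] to be
   constant. *)
destruct (PM _ u0) as [s0|s0].
2:{ left; apply Cst; intros t Ht; apply Rle_antisym; [apply Mon; lra|].
    rewrite s0; apply B. }
destruct (PM _ (hp_pole_PI _ _ _ _ H)) as [sP|sP].
{ left; apply Cst; intros t Ht; apply Rle_antisym; [apply Mon; lra|].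
  rewrite s0, <- sP; apply Mon; lra. }
right.
assert (sx : forall x y, s * x = y -> x = s * y).
{ intros x y E; rewrite <- E; replace (s * (s * x)) with (s ^ 2 * x) by ring.
  rewrite s2; ring. }
apply sx in s0 as u0'; apply sx in sP as uP'.
(* Since [1 - u^2] solves a linear equation, one interior zero would make it vanish identically;
   then [u' = 0], against the opposite values of [u] at the poles. *)
assert (V : forall t, 0 < t < PI -> 1 - u t ^ 2 <> 0).
{ intros t Ht Q.
  assert (Z : forall x, 0 < x < PI -> 1 - u x ^ 2 = 0).
  { apply linear_ode_zero with (M := 2 * k) (c := fun x => 2 * s * k * u x)
      (y := fun x => 1 - u x ^ 2) (dy := fun x => - 2 * u x * Derive u x) (t0 := t); auto.
    - intros x Hx; auto_derive; [repeat split; apply H|eta_Derive; ring].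
    - intros x Hx; transitivity (- 2 * u x * (sin x * Derive u x)); [ring|].
      rewrite U by auto; ring.
    - intros x Hx; pose proof (B x); apply Rabs_le; nra. }
  assert (E : u 0 = u PI); [|lra].
  apply derive_zero_eq with (df := Derive u); [lra| |].
  - intros x _; apply Derive_correct, H.
  - intros x Hx; pose proof (sin_gt_0 x (proj1 Hx) (proj2 Hx)).
    apply (Rmult_eq_reg_l (sin x)); [|lra]; rewrite U, Z by auto; ring. }
assert (Y : forall t, 0 < t < PI -> 0 < 1 + s * u t).
{ intros t Ht; pose proof (B t); specialize (V t Ht).
  replace (1 - u t ^ 2) with ((1 + s * u t) * (1 - s * u t)) in V
    by (transitivity (1 - s ^ 2 * u t ^ 2); [ring|rewrite s2; ring]).
  assert (1 + s * u t <> 0) by (intros Q; apply V; rewrite Q; ring); lra. }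
(* The products [a a' + b b'] and [a b' - b a'] are both known, and they determine [a'] and [b']
   because [a^2 + b^2] is nonzero by [V]. *)
assert (AB : forall t, 0 < t < PI ->
  sin t * Derive a t = s * k * u t * a t /\ sin t * Derive b t = s * k * u t * b t).
{ intros t Ht; specialize (V t Ht).
  pose proof (profile_hopf_im k u a b t H Ht) as Hi.
  pose proof (profile_orthogonal k u a b t H) as O.
  pose proof (hp_sphere _ _ _ _ H t) as S.
  replace (1 - u t ^ 2) with (a t ^ 2 + b t ^ 2) in V by lra.
  assert (W : sin t * (a t * Derive a t + b t * Derive b t)
    = s * k * u t * (a t ^ 2 + b t ^ 2)).
  { replace (a t * Derive a t + b t * Derive b t) with (- (u t * Derive u t)) by lra.
    transitivity (- u t * (sin t * Derive u t)); [ring|]; rewrite U by auto.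
    replace (a t ^ 2 + b t ^ 2) with (1 - u t ^ 2) by lra; ring. }
  split; apply (Rmult_eq_reg_l (a t ^ 2 + b t ^ 2)); auto.
  - transitivity (a t * (sin t * (a t * Derive a t + b t * Derive b t))
      - sin t * b t * (a t * Derive b t - b t * Derive a t)); [ring|].
    rewrite W, Hi; ring.
  - transitivity (b t * (sin t * (a t * Derive a t + b t * Derive b t))
      + sin t * a t * (a t * Derive b t - b t * Derive a t)); [ring|].
    rewrite W, Hi; ring. }
(* By the equations for [f] and [u], the quotient of [f] by [(1 + s u)] and by the power [k] of
   [tan_half] has zero derivative. *)
assert (Q : forall f : R -> R, (forall t : R, ex_derive f t) ->
  (forall t, 0 < t < PI -> sin t * Derive f t = s * k * u t * f t) ->
  exists m, forall t, 0 < t < PI ->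
    f t = s * (1 + s * u t) * m * Rpower (tan_half t) k).
{ intros f Df Ef.
  set (g := fun t : R => f t / (1 + s * u t) * exp (- k * ln_tan_half t)).
  (* The factor [s] cancels the leading [s] of the formula, since [s^2 = 1]. *)
  exists (s * g (PI / 2)); intros t Ht.
  assert (Dg : forall x, 0 < x < PI -> is_derive g x 0).
  { intros x Hx; unfold g; pose proof (sin_gt_0 x (proj1 Hx) (proj2 Hx)).
    pose proof (is_derive_ln_tan_half x Hx) as DL; pose proof (Y x Hx).
    auto_derive.
    - repeat split; try apply H; auto; [lra|now exists (/ sin x)].
    - eta_Derive; replace (Derive ln_tan_half x) with (/ sin x)
        by (symmetry; now apply is_derive_unique).
      replace (Derive f x) with (s * k * u x * f x / sin x)
        by (rewrite <- Ef by auto; field; lra).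
      replace (Derive u x) with (- s * k * (1 - u x ^ 2) / sin x)
        by (rewrite <- U by auto; field; lra).
      field_simplify_eq; [|lra].
      destruct Hs as [-> | ->]; ring. }
  assert (G : g t = g (PI / 2)).
  { destruct (Rle_dec t (PI / 2)).
    - apply derive_zero_eq with (df := fun _ => 0); auto; intros; apply Dg; lra.
    - symmetry; apply derive_zero_eq with (df := fun _ => 0); [lra| |auto].
      intros; apply Dg; lra. }
  rewrite <- G; unfold g, Rpower; change (ln (tan_half t)) with (ln_tan_half t);
    pose proof (Y t Ht).
  transitivity (s ^ 2 * f t * (exp (- k * ln_tan_half t) * exp (k * ln_tan_half t)));
    [|field; lra].
  rewrite <- exp_plus; replace (- k * ln_tan_half t + k * ln_tan_half t) with 0 by ring.
  rewrite exp_0, s2; ring. }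
destruct (Q a (hp_a1 _ _ _ _ H) (fun t Ht => proj1 (AB t Ht))) as [m1 M1].
destruct (Q b (hp_b1 _ _ _ _ H) (fun t Ht => proj2 (AB t Ht))) as [m2 M2].
exists s, m1, m2; repeat split; auto; try lra.
(* If both constants were zero, [a] and [b] would vanish at the equator, contradicting [V]. *)
destruct (Req_dec m1 0) as [E1|E1]; [right; intros E2|now left].
assert (HP : 0 < PI / 2 < PI) by lra.
apply (V _ HP).
pose proof (hp_sphere _ _ _ _ H (PI / 2)) as S.
rewrite M1, M2, E1, E2 in S by auto; lra.
Qed.

(** * From the sphere to the meridian *)

Lemma rot_meridian t phi : rot phi (sin t, 0, cos t) = sph t phi.
Proof.
unfold rot, sph; f_equal; f_equal; ring.
Qed.

Lemma covariant_sph k f g t phi : covariant k f g ->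
  f (sph t phi) = cos (k * phi) * meridian f t - sin (k * phi) * meridian g t /\
  g (sph t phi) = sin (k * phi) * meridian f t + cos (k * phi) * meridian g t.
Proof.
intros H; rewrite <- rot_meridian; apply H, meridian_S2.
Qed.

Lemma invariant_sph f : covariant 0 f f -> forall t phi, f (sph t phi) = meridian f t.
Proof.
intros H t phi; destruct (covariant_sph 0 f f t phi H) as [-> _].
rewrite Rmult_0_l, cos_0, sin_0; ring.
Qed.

Lemma sph_S2 t phi : S2 (sph t phi).
Proof.
unfold S2, sph; pose proof (sin2_cos2 t) as P; pose proof (sin2_cos2 phi) as Q;
  unfold Rsqr in P, Q.
transitivity (sin t * sin t * (sin phi * sin phi + cos phi * cos phi) + cos t * cos t);
  [ring | rewrite Q; lra].
Qed.

Lemma is_derive_sph f t phi : diff_off0 (hext f) ->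
  is_derive (fun s => f (sph s phi)) t
    (cos t * cos phi * partial (1, 0, 0) (hext f) (sph t phi)
     + cos t * sin phi * partial (0, 1, 0) (hext f) (sph t phi)
     + - sin t * partial (0, 0, 1) (hext f) (sph t phi)).
Proof.
intros D.
apply is_derive_ext with (fun s => hext f (sin s * cos phi, sin s * sin phi, cos s)).
- intros s; apply hext_S2, (sph_S2 s phi).
- apply (chain_rule (hext f) (fun s => sin s * cos phi) (fun s => sin s * sin phi) cos).
  + apply D, S2_neq0, (sph_S2 t phi).
  + auto_derive; auto; ring.
  + auto_derive; auto; ring.
  + auto_derive; auto; ring.
Qed.

(* The gradient is decomposed in the orthonormal frame (x, d/dt, 1/sin t d/dphi). *)
Lemma gradT_sq_frame f t phi D : diff_off0 (hext f) -> sin t <> 0 ->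
  sph t phi <> (0, 0, 0) ->
  D = sin t * cos phi * partial (0, 1, 0) (hext f) (sph t phi)
      - sin t * sin phi * partial (1, 0, 0) (hext f) (sph t phi) ->
  gradT_sq f (sph t phi) = Derive (fun s => f (sph s phi)) t ^ 2 + D ^ 2 / sin t ^ 2.
Proof.
intros Df S0 N ->.
rewrite (is_derive_unique (fun s : R => f (sph s phi)) _ _ (is_derive_sph f t phi Df)).
pose proof (euler_identity f _ _ _ Df N) as E.
unfold gradT_sq, basis3, sum_list; simpl map; simpl fold_right.
change (sin t * cos phi, sin t * sin phi, cos t) with (sph t phi) in E.
set (F1 := partial (1, 0, 0) (hext f) (sph t phi)) in *.
set (F2 := partial (0, 1, 0) (hext f) (sph t phi)) in *.
set (F3 := partial (0, 0, 1) (hext f) (sph t phi)) in *.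
pose proof (sin2_cos2 t) as P; pose proof (sin2_cos2 phi) as Q; unfold Rsqr in P, Q.
replace ((sin t * cos phi * F2 - sin t * sin phi * F1) ^ 2 / sin t ^ 2)
  with ((cos phi * F2 - sin phi * F1) ^ 2) by (field; auto).
transitivity ((cos t * cos phi * F1 + cos t * sin phi * F2 + - sin t * F3) ^ 2
  + (sin t * cos phi * F1 + sin t * sin phi * F2 + cos t * F3) ^ 2
  + (cos phi * F2 - sin phi * F1) ^ 2); [|rewrite E; ring].
transitivity ((sin t * sin t + cos t * cos t) * ((cos phi * F1 + sin phi * F2) ^ 2 + F3 ^ 2)
  + (cos phi * F2 - sin phi * F1) ^ 2); [rewrite P | ring].
transitivity ((sin phi * sin phi + cos phi * cos phi) * (F1 ^ 2 + F2 ^ 2) + F3 ^ 2);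
  [rewrite Q|]; ring.
Qed.

(** At longitude [phi] the pair is its value on the meridian turned by the angle [k phi], which
    preserves sums of squares. The derivative along a parallel is [k] times the pair turned by a
    right angle, divided by the radius [sin t]. *)
Lemma gradT_sq_pair k f g t phi : covariant k f g ->
  diff_off0 (hext f) -> diff_off0 (hext g) -> sin t <> 0 ->
  gradT_sq f (sph t phi) + gradT_sq g (sph t phi) =
    Derive (meridian f) t ^ 2 + Derive (meridian g) t ^ 2
    + k ^ 2 * (meridian f t ^ 2 + meridian g t ^ 2) / sin t ^ 2.
Proof.
intros H Df Dg S0.
assert (N : sph t phi <> (0, 0, 0)) by apply S2_neq0, sph_S2.
destruct (rotation_identity k f g _ _ _ H Df Dg N) as [Rf Rg].
change (sin t * cos phi, sin t * sin phi, cos t) with (sph t phi) in Rf, Rg.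
rewrite (gradT_sq_frame f t phi _ Df S0 N (eq_sym Rf)).
rewrite (gradT_sq_frame g t phi _ Dg S0 N (eq_sym Rg)).
rewrite !hext_S2 by apply sph_S2.
destruct (covariant_sph k f g t phi H) as [-> ->].
rewrite (Derive_ext (fun s => f (sph s phi)) (fun s =>
  cos (k * phi) * meridian f s - sin (k * phi) * meridian g s))
  by (intros s; apply (covariant_sph k f g s phi H)).
rewrite (Derive_ext (fun s => g (sph s phi)) (fun s =>
  sin (k * phi) * meridian f s + cos (k * phi) * meridian g s))
  by (intros s; apply (covariant_sph k f g s phi H)).
assert (Mf : ex_derive (meridian f) t) by (eexists; apply is_derive_meridian, Df).
assert (Mg : ex_derive (meridian g) t) by (eexists; apply is_derive_meridian, Dg).
rewrite Derive_minus, Derive_plus, !Derive_scal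
  by (apply ex_derive_scal; assumption).
pose proof (sin2_cos2 (k * phi)) as P; unfold Rsqr in P.
set (s := sin (k * phi)) in *; set (c := cos (k * phi)) in *.
transitivity ((s * s + c * c) * (Derive (meridian f) t ^ 2 + Derive (meridian g) t ^ 2
  + k ^ 2 * (meridian f t ^ 2 + meridian g t ^ 2) / sin t ^ 2));
  [field; auto | rewrite P; ring].
Qed.

(** [(f0, f + i g)] is an equivariant harmonic map into the sphere of [R (+) C] of
    energy density [e], the rotation acting on [C] with weight [k]. *)
Record equivariant_harmonic (k : R) (f0 f g e : E3 -> R) : Prop := {
  eh_smooth0 : smooth_on_S2 f0;
  eh_smooth1 : smooth_on_S2 f;
  eh_smooth2 : smooth_on_S2 g;
  eh_cov0 : covariant 0 f0 f0;
  eh_cov : covariant k f g;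
  eh_sphere : forall x, S2 x -> f0 x ^ 2 + f x ^ 2 + g x ^ 2 = 1;
  eh_eq0 : forall x, S2 x -> LaplT f0 x + e x * f0 x = 0;
  eh_eq1 : forall x, S2 x -> LaplT f x + e x * f x = 0;
  eh_eq2 : forall x, S2 x -> LaplT g x + e x * g x = 0;
  eh_density : forall t phi, sin t <> 0 ->
    e (sph t phi) = gradT_sq f0 (sph t phi)
                    + (gradT_sq f (sph t phi) + gradT_sq g (sph t phi))
}.

(** The Laplacian formula concerns the first member of a pair and sees only [k ^ 2]; swapping makes
    it available for the imaginary part. *)
Lemma covariant_swap k f g : covariant k f g -> covariant (- k) g f.
Proof.
intros H a x Hx; destruct (H a x Hx) as [-> ->].
rewrite Ropp_mult_distr_l_reverse, cos_neg, sin_neg; split; ring.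
Qed.

(** Rotations fix the poles, while the one of angle [PI / k] acts on the values by -1. *)
Lemma covariant_pole k f g z : k <> 0 -> covariant k f g -> S2 (0, 0, z) ->
  f (0, 0, z) = 0 /\ g (0, 0, z) = 0.
Proof.
intros Hk H Hz; destruct (H (PI / k) (0, 0, z) Hz) as [F G].
replace (rot (PI / k) (0, 0, z)) with ((0, 0, z) : E3) in F, G
  by (unfold rot; f_equal; f_equal; ring).
replace (k * (PI / k)) with PI in F, G by (field; auto).
rewrite cos_PI, sin_PI in F, G; lra.
Qed.

Lemma equivariant_harmonic_density k f0 f g e t phi : equivariant_harmonic k f0 f g e ->
  sin t <> 0 ->
  e (sph t phi) = Derive (meridian f0) t ^ 2 + Derive (meridian f) t ^ 2
    + Derive (meridian g) t ^ 2
    + k ^ 2 * (meridian f t ^ 2 + meridian g t ^ 2) / sin t ^ 2.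
Proof.
intros H S0; rewrite (eh_density _ _ _ _ _ H) by exact S0.
(* In weight 0 with both members equal to [f0], the pair formula counts the gradient of [f0]
   twice. *)
pose proof (gradT_sq_pair 0 f0 f0 t phi (eh_cov0 _ _ _ _ _ H)
  (smooth_diff _ (eh_smooth0 _ _ _ _ _ H)) (smooth_diff _ (eh_smooth0 _ _ _ _ _ H)) S0) as G0.
rewrite (gradT_sq_pair k f g t phi (eh_cov _ _ _ _ _ H)
  (smooth_diff _ (eh_smooth1 _ _ _ _ _ H)) (smooth_diff _ (eh_smooth2 _ _ _ _ _ H)) S0).
replace (gradT_sq f0 (sph t phi)) with (Derive (meridian f0) t ^ 2); [ring|].
replace (0 ^ 2 * (meridian f0 t ^ 2 + meridian f0 t ^ 2) / sin t ^ 2) with 0 in G0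
  by (field; auto).
lra.
Qed.

Lemma sph_meridian t : sph t 0 = (sin t, 0, cos t).
Proof.
unfold sph; rewrite cos_0, sin_0; f_equal; f_equal; ring.
Qed.

Lemma equivariant_harmonic_profile k f0 f g e : k <> 0 ->
  equivariant_harmonic k f0 f g e ->
  harmonic_profile k (meridian f0) (meridian f) (meridian g).
Proof.
intros Hk H.
assert (D1 : forall h t, smooth_on_S2 h -> ex_derive (meridian h) t)
  by (intros h t S; eexists; apply is_derive_meridian, smooth_diff, S).
assert (D2 : forall h t, smooth_on_S2 h -> ex_derive (Derive (meridian h)) t)
  by (intros h t S; eexists; apply is_derive2_meridian, S).
assert (N : S2 (0, 0, 1)) by (unfold S2; ring).
assert (P : S2 (0, 0, -1)) by (unfold S2; ring).
destruct (covariant_pole k f g 1 Hk (eh_cov _ _ _ _ _ H) N) as [Nf Ng].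
destruct (covariant_pole k f g (-1) Hk (eh_cov _ _ _ _ _ H) P) as [Pf Pg].
pose proof (eh_smooth0 _ _ _ _ _ H) as S0; pose proof (eh_smooth1 _ _ _ _ _ H) as S1;
  pose proof (eh_smooth2 _ _ _ _ _ H) as S2'.
constructor; auto.
- intros t; apply (eh_sphere _ _ _ _ _ H), meridian_S2.
- unfold meridian; rewrite sin_0, cos_0; exact Nf.
- unfold meridian; rewrite sin_0, cos_0; exact Ng.
- unfold meridian; rewrite sin_PI, cos_PI.
  rewrite <- (eh_sphere _ _ _ _ _ H _ P), Pf, Pg; ring.
- intros t Ht E.
  assert (S : sin t <> 0) by (pose proof (sin_gt_0 t (proj1 Ht) (proj2 Ht)); lra).
  assert (EE : E = sin t ^ 2 * e (sin t, 0, cos t)).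
  { rewrite <- sph_meridian, (equivariant_harmonic_density k f0 f g e) by auto.
    unfold E; field; auto. }
  (* The harmonic map equation times [sin t ^ 2], in a form common to the weights 0, [k] and
     [- k]. *)
  assert (L : forall j h h', covariant j h h' -> smooth_on_S2 h -> smooth_on_S2 h' ->
    LaplT h (sin t, 0, cos t) + e (sin t, 0, cos t) * h (sin t, 0, cos t) = 0 ->
    sin t ^ 2 * Derive (Derive (meridian h)) t + sin t * cos t * Derive (meridian h) t
      - j ^ 2 * meridian h t + E * meridian h t = 0).
  { intros j h h' C Sh Sh' Q; rewrite (LaplT_meridian j h h' t C Sh Sh' S) in Q.
    change (h (sin t, 0, cos t)) with (meridian h t) in Q.
    rewrite EE; set (d := e (sin t, 0, cos t)) in *.
    transitivity (sin t ^ 2 * 0); [rewrite <- Q | ring].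
    field; auto. }
  pose proof (meridian_S2 t) as M; destruct H.
  split; [|split].
  + rewrite <- (L 0 f0 f0); auto; ring.
  + eapply L; eauto.
  + rewrite <- (L (- k) g f); auto using covariant_swap; ring.
Qed.

(** * Energy, degree and stereographic form *)

Lemma polar_form x y : x ^ 2 + y ^ 2 = 1 -> exists phi, x = cos phi /\ y = sin phi.
Proof.
intros H.
assert (X : -1 <= x <= 1) by (pose proof (pow2_ge_0 y); nra).
assert (Y : y = sin (acos x) \/ y = - sin (acos x)).
{ rewrite sin_acos by auto.
  assert (S : sqrt (1 - x²) ^ 2 = y ^ 2)
    by (rewrite pow2_sqrt; unfold Rsqr; [|pose proof (pow2_ge_0 y)]; lra).
  set (q := sqrt (1 - x²)) in *.
  assert (Q : (y - q) * (y + q) = 0) by lra.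
  apply Rmult_integral in Q as [Q|Q]; [left|right]; lra. }
destruct Y as [Y|Y].
- exists (acos x); now rewrite cos_acos.
- exists (- acos x); now rewrite cos_neg, sin_neg, cos_acos.
Qed.

Lemma sph_surj x : S2 x ->
  exists t phi, 0 <= t <= PI /\ x = sph t phi.
Proof.
destruct x as [[x1 x2] x3]; intros H; unfold S2 in H.
assert (X : -1 <= x3 <= 1) by (pose proof (pow2_ge_0 x1); pose proof (pow2_ge_0 x2); nra).
exists (acos x3).
assert (S : sin (acos x3) ^ 2 = x1 ^ 2 + x2 ^ 2).
{ rewrite sin_acos, pow2_sqrt by (unfold Rsqr; nra); unfold Rsqr; lra. }
destruct (Req_dec (sin (acos x3)) 0) as [Q|Q].
- exists 0; split; [apply acos_bound|].
  unfold sph; rewrite cos_acos, Q by auto; rewrite Q in S.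
  pose proof (pow2_ge_0 x1); pose proof (pow2_ge_0 x2).
  rewrite (Rsqr_0_uniq x1), (Rsqr_0_uniq x2) by (unfold Rsqr; lra).
  f_equal; f_equal; ring.
- set (q := sin (acos x3)) in *.
  destruct (polar_form (x1 / q) (x2 / q)) as [phi [P1 P2]].
  { transitivity ((x1 ^ 2 + x2 ^ 2) / q ^ 2); [field; auto|rewrite <- S; field; auto]. }
  exists phi; split; [apply acos_bound|].
  unfold sph; fold q; rewrite cos_acos, <- P1, <- P2 by auto.
  apply f_equal2; [apply f_equal2|reflexivity]; field; auto.
Qed.

Lemma RInt_of_derive (f : R -> R) c : (forall t, ex_derive f t) ->
  (forall t, ex_derive (Derive f) t) ->
  RInt (fun t => c * Derive f t) 0 PI = c * (f PI - f 0).
Proof.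
intros D1 D2; apply is_RInt_unique.
evar_last.
- apply (is_RInt_derive (fun t => c * f t) (fun t => c * Derive f t)).
  + intros t _; apply is_derive_scal, Derive_correct, D1.
  + intros t _; apply (ex_derive_continuous (fun t => c * Derive f t)).
    apply ex_derive_scal, D2.
- unfold minus, plus, opp; simpl; ring.
Qed.

(** By the real Hopf relation the two parts of the energy density are equal, so the integrand is
    [2 k^2 (1 - u^2) / sin t]. The first order equation identifies this with [- 2 s k u'], a total
    derivative. *)
Lemma int_S2_density k f0 f g e s : equivariant_harmonic k f0 f g e -> k <> 0 ->
  s ^ 2 = 1 ->
  (forall t, 0 < t < PI ->
    sin t * Derive (meridian f0) t = - s * k * (1 - meridian f0 t ^ 2)) ->
  int_S2 e = 4 * PI * (- s * k) * (meridian f0 PI - meridian f0 0).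
Proof.
intros H Hk Hs U.
pose proof (equivariant_harmonic_profile k f0 f g e Hk H) as HP.
unfold int_S2.
rewrite (RInt_ext _ (fun _ => 2 * (- s * k) * (meridian f0 PI - meridian f0 0))).
- rewrite RInt_const.
  change (@eq R ((2 * PI - 0) * (2 * (- s * k) * (meridian f0 PI - meridian f0 0)))
    (4 * PI * (- s * k) * (meridian f0 PI - meridian f0 0))); ring.
- intros phi _.
  etransitivity; [|apply RInt_of_derive; apply HP].
  apply RInt_ext; intros t; pose proof PI_RGT_0.
  rewrite Rmin_left, Rmax_right by lra; intros Ht.
  assert (S0 : 0 < sin t) by (now apply sin_gt_0).
  rewrite (equivariant_harmonic_density k f0 f g e t phi H) by lra.
  pose proof (profile_hopf_re _ _ _ _ t HP ltac:(lra)) as Hr.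
  assert (SP : meridian f t ^ 2 + meridian g t ^ 2 = 1 - meridian f0 t ^ 2)
    by (pose proof (hp_sphere _ _ _ _ HP t); lra).
  replace (Derive (meridian f0) t ^ 2 + Derive (meridian f) t ^ 2 + Derive (meridian g) t ^ 2)
    with (k ^ 2 * (meridian f t ^ 2 + meridian g t ^ 2) / sin t ^ 2)
    by (rewrite <- Hr; field; lra).
  replace (Derive (meridian f0) t) with (- s * k * (1 - meridian f0 t ^ 2) / sin t)
    by (rewrite <- U by auto; field; lra).
  rewrite SP.
  match goal with |- ?l = ?r => change (@eq R l r) end.
  transitivity (2 * k ^ 2 * (1 - meridian f0 t ^ 2) / sin t); [field; lra|].
  transitivity (2 * s ^ 2 * k ^ 2 * (1 - meridian f0 t ^ 2) / sin t);
    [rewrite Hs|]; field; lra.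
Qed.

(** The sphere constraint and its derivative reduce the pulled-back area density to [- k u'],
    independent of [phi], so the degree depends only on the values at the poles. *)
Lemma deg_S2_equivariant k f0 f g e : equivariant_harmonic k f0 f g e -> k <> 0 ->
  deg_S2 (fun x => (f x, g x, f0 x)) = - k / 2 * (meridian f0 PI - meridian f0 0).
Proof.
intros H Hk.
pose proof (equivariant_harmonic_profile k f0 f g e Hk H) as HP.
pose proof PI_RGT_0.
pose proof (invariant_sph f0) as F0; specialize (F0 (eh_cov0 _ _ _ _ _ H)).
unfold deg_S2.
rewrite (RInt_ext _ (fun _ => - k * (meridian f0 PI - meridian f0 0))).
- rewrite RInt_const.
  change (/ (4 * PI) * ((2 * PI - 0) * (- k * (meridian f0 PI - meridian f0 0)))
    = - k / 2 * (meridian f0 PI - meridian f0 0)); field; lra.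
- intros phi _.
  etransitivity; [|apply RInt_of_derive; apply HP].
  apply RInt_ext; intros t _.
  unfold Derive3; simpl fst; simpl snd.
  destruct (covariant_sph k f g t phi (eh_cov _ _ _ _ _ H)) as [-> ->].
  rewrite F0.
  assert (DF : forall r, Derive (fun s => f (sph s r)) t =
    cos (k * r) * Derive (meridian f) t - sin (k * r) * Derive (meridian g) t).
  { intros r; rewrite (Derive_ext _ (fun s =>
      cos (k * r) * meridian f s - sin (k * r) * meridian g s))
      by (intros s; apply (covariant_sph k f g s r), H).
    rewrite Derive_minus, !Derive_scal by (apply ex_derive_scal, HP); reflexivity. }
  assert (DG : forall r, Derive (fun s => g (sph s r)) t =
    sin (k * r) * Derive (meridian f) t + cos (k * r) * Derive (meridian g) t).
  { intros r; rewrite (Derive_ext _ (fun s =>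
      sin (k * r) * meridian f s + cos (k * r) * meridian g s))
      by (intros s; apply (covariant_sph k f g s r), H).
    rewrite Derive_plus, !Derive_scal by (apply ex_derive_scal, HP); reflexivity. }
  assert (PF : Derive (fun s => f (sph t s)) phi =
    - k * (sin (k * phi) * meridian f t + cos (k * phi) * meridian g t)).
  { rewrite (Derive_ext _ (fun s =>
      cos (k * s) * meridian f t - sin (k * s) * meridian g t))
      by (intros s; apply (covariant_sph k f g t s), H).
    apply is_derive_unique; auto_derive; auto; ring. }
  assert (PG : Derive (fun s => g (sph t s)) phi =
    k * (cos (k * phi) * meridian f t - sin (k * phi) * meridian g t)).
  { rewrite (Derive_ext _ (fun s =>
      sin (k * s) * meridian f t + cos (k * s) * meridian g t))
      by (intros s; apply (covariant_sph k f g t s), H).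
    apply is_derive_unique; auto_derive; auto; ring. }
  rewrite DF, DG, PF, PG.
  rewrite (Derive_ext (fun s => f0 (sph s phi)) (meridian f0)) by (intros s; apply F0).
  rewrite (Derive_ext (fun s => f0 (sph t s)) (fun _ => meridian f0 t))
    by (intros s; apply F0).
  rewrite Derive_const.
  pose proof (profile_orthogonal _ _ _ _ t HP) as O.
  pose proof (hp_sphere _ _ _ _ HP t) as S.
  pose proof (sin2_cos2 (k * phi)) as P; unfold Rsqr in P.
  set (sn := sin (k * phi)) in *; set (cs := cos (k * phi)) in *.
  set (a := meridian f t) in *; set (b := meridian g t) in *; set (u := meridian f0 t) in *.
  set (a' := Derive (meridian f) t) in *; set (b' := Derive (meridian g) t) in *.
  set (u' := Derive (meridian f0) t) in *.
  unfold det3.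
  match goal with |- ?l = ?r => change (@eq R l r) end.
  transitivity (- k * (sn * sn + cs * cs) * ((a ^ 2 + b ^ 2) * u' - u * (a * a' + b * b')));
    [ring|].
  rewrite P; replace (a * a' + b * b') with (- (u * u')) by lra.
  replace (a ^ 2 + b ^ 2) with (1 - u ^ 2) by lra; ring.
Qed.

Lemma tan_half_surj r : 0 < r -> exists t, 0 < t < PI /\ tan_half t = r.
Proof.
intros Hr; exists (2 * atan r).
assert (A : 0 < atan r) by (rewrite <- atan_0; now apply atan_increasing).
pose proof (atan_bound r).
split; [lra|].
assert (C : 0 < cos (atan r)) by (apply cos_gt_0; lra).
unfold tan_half; rewrite sin_2a, cos_2a_cos.
transitivity (tan (atan r)); [unfold tan|apply tan_atan].
replace (1 + (2 * cos (atan r) * cos (atan r) - 1)) with (2 * cos (atan r) * cos (atan r))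
  by ring.
field; lra.
Qed.

Lemma sigma2_inv_sph t phi : 0 < t < PI ->
  sigma2_inv (tan_half t * cos phi, tan_half t * sin phi) = sph t phi.
Proof.
intros Ht; pose proof (cos_gt_m1 t ltac:(lra)) as C.
rewrite <- (sigma2K (sph t phi) (sph_S2 t phi)).
- f_equal; unfold sigma2, sph, tan_half, Cdiv, Cmult, Cinv, RtoC; simpl.
  f_equal; field; lra.
- unfold sph, pole2; intros E; injection E; lra.
Qed.

Lemma polar_sigma2_inv z : z <> RtoC 0 -> exists t phi, 0 < t < PI /\
  z = (tan_half t * cos phi, tan_half t * sin phi) /\ sigma2_inv z = sph t phi.
Proof.
intros Hz; pose proof (proj1 (Cmod_gt_0 z) Hz) as R.
destruct (tan_half_surj _ R) as [t [Ht T]].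
pose proof (Cmod2_alt z) as M.
destruct (polar_form (Re z / Cmod z) (Im z / Cmod z)) as [phi [P1 P2]].
{ transitivity ((Re z ^ 2 + Im z ^ 2) / Cmod z ^ 2); [field; lra|].
  rewrite <- M; field; lra. }
exists t, phi; split; auto.
assert (E : z = (tan_half t * cos phi, tan_half t * sin phi)).
{ rewrite T, <- P1, <- P2; destruct z as [x y]; simpl Re; simpl Im; f_equal; field; lra. }
split; auto; rewrite E; now apply sigma2_inv_sph.
Qed.

(** Here [p1 + i p2] is [(m1 + i m2) exp (i k phi) tan (t / 2) ^ k], and the last three formulas are
    [s] times its inverse stereographic projection. *)
Lemma equivariant_harmonic_classification k f0 f g e : 0 < k ->
  equivariant_harmonic k f0 f g e ->
  (exists c, forall x, S2 x -> f0 x = c /\ f x = 0 /\ g x = 0) \/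
  exists s m1 m2, (s = 1 \/ s = -1) /\ (m1 <> 0 \/ m2 <> 0) /\
    int_S2 e = 8 * PI * k /\
    deg_S2 (fun x => (f x, g x, f0 x)) = s * k /\
    f0 (0, 0, -1) = - s /\ f0 (0, 0, 1) = s /\
    forall t phi, 0 < t < PI ->
      let p1 := (m1 * cos (k * phi) - m2 * sin (k * phi)) * Rpower (tan_half t) k in
      let p2 := (m1 * sin (k * phi) + m2 * cos (k * phi)) * Rpower (tan_half t) k in
      let q := p1 ^ 2 + p2 ^ 2 in
      f0 (sph t phi) = s * ((1 - q) / (1 + q)) /\
      f (sph t phi) = s * (2 * p1 / (1 + q)) /\
      g (sph t phi) = s * (2 * p2 / (1 + q)).
Proof.
intros Hk H; assert (Hk' : k <> 0) by lra.
pose proof (equivariant_harmonic_profile k f0 f g e Hk' H) as HP.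
pose proof (invariant_sph f0) as F0; specialize (F0 (eh_cov0 _ _ _ _ _ H)).
destruct (profile_classification _ _ _ _ Hk HP)
  as [C|(s & m1 & m2 & Hs & Hm & U0 & UP & E)].
- left; exists (meridian f0 0); intros x Hx.
  destruct (sph_surj x Hx) as (t & phi & Ht & ->).
  destruct (covariant_sph k f g t phi (eh_cov _ _ _ _ _ H)) as [-> ->].
  destruct (C t Ht) as (Cu & -> & ->); rewrite F0; repeat split; auto; ring.
- right; exists s, m1, m2.
  assert (s2 : s ^ 2 = 1) by (destruct Hs as [-> | ->]; ring).
  refine (conj Hs (conj Hm (conj _ (conj _ (conj _ (conj _ _)))))).
  + rewrite (int_S2_density k f0 f g e s H Hk' s2).
    * rewrite UP, U0; transitivity (8 * PI * k * s ^ 2); [ring|rewrite s2; ring].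
    * intros t Ht; apply (E t Ht).
  + rewrite (deg_S2_equivariant k f0 f g e H Hk'), UP, U0; field.
  + rewrite <- UP; unfold meridian; now rewrite sin_PI, cos_PI.
  + rewrite <- U0; unfold meridian; now rewrite sin_0, cos_0.
  + intros t phi Ht p1 p2 q.
    destruct (covariant_sph k f g t phi (eh_cov _ _ _ _ _ H)) as [-> ->]; rewrite F0.
    destruct (E t Ht) as (Y & _ & A & B).
    pose proof (hp_sphere _ _ _ _ HP t) as S.
    pose proof (sin2_cos2 (k * phi)) as P; unfold Rsqr in P.
    set (T := Rpower (tan_half t) k) in *.
    set (sn := sin (k * phi)) in *; set (cs := cos (k * phi)) in *.
    set (u := meridian f0 t) in *; set (y := 1 + s * u) in *.
    assert (Q : q = (m1 ^ 2 + m2 ^ 2) * T ^ 2).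
    { unfold q, p1, p2; transitivity ((sn * sn + cs * cs) * ((m1 ^ 2 + m2 ^ 2) * T ^ 2));
        [ring | rewrite P; ring]. }
    assert (Q0 : 0 <= q)
      by (unfold q; pose proof (pow2_ge_0 p1); pose proof (pow2_ge_0 p2); lra).
    assert (Uy : u = s * (y - 1)).
    { unfold y; transitivity (s ^ 2 * u); [rewrite s2|]; ring. }
    (* The sphere constraint with [u = s (y - 1)] and [a^2 + b^2 = y^2 q] reads [y^2 (1 + q) = 2 y],
       and [y] is positive. *)
    assert (Yq : y = 2 / (1 + q)).
    { apply (Rmult_eq_reg_l (y * (1 + q))); [|apply Rmult_integral_contrapositive; lra].
      transitivity (2 * y); [|field; lra].
      transitivity (s ^ 2 * (y - 1) ^ 2 - 1 + 2 * y + s ^ 2 * y ^ 2 * q);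
        [rewrite s2; ring|].
      replace (s ^ 2 * y ^ 2 * q) with (meridian f t ^ 2 + meridian g t ^ 2)
        by (rewrite A, B, Q; ring).
      rewrite Uy in S; lra. }
    rewrite A, B, Uy, Yq; unfold p1, p2; repeat split; field; lra.
Qed.

(** [pw] is the power map [z |-> z ^ k]. *)
Lemma equivariant_harmonic_sigma2 k f0 f g e (pw : C -> C) : 0 < k ->
  (forall T phi, 0 < T -> pw (T * cos phi, T * sin phi)
     = (Rpower T k * cos (k * phi), Rpower T k * sin (k * phi))) ->
  pw (RtoC 0) = RtoC 0 ->
  equivariant_harmonic k f0 f g e ->
  (exists c, forall x, S2 x -> f0 x = c /\ f x = 0 /\ g x = 0) \/
  exists s mu, (s = 1 \/ s = -1) /\ mu <> RtoC 0 /\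
    int_S2 e = 8 * PI * k /\
    deg_S2 (fun x => (f x, g x, f0 x)) = s * k /\
    f0 pole2 = - s /\ f pole2 = 0 /\ g pole2 = 0 /\
    forall z, (f (sigma2_inv z), g (sigma2_inv z), f0 (sigma2_inv z))
      = scal s (sigma2_inv (Cmult mu (pw z))).
Proof.
intros Hk Hpw Hpw0 H.
destruct (equivariant_harmonic_classification k f0 f g e Hk H)
  as [C|(s & m1 & m2 & Hs & Hm & I & D & P0 & N0 & E)]; [now left|right].
assert (P : S2 (0, 0, -1)) by (unfold S2; ring).
assert (N : S2 (0, 0, 1)) by (unfold S2; ring).
destruct (covariant_pole k f g _ ltac:(lra) (eh_cov _ _ _ _ _ H) P) as [Pf Pg].
destruct (covariant_pole k f g _ ltac:(lra) (eh_cov _ _ _ _ _ H) N) as [Nf Ng].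
assert (M : (m1, m2) <> RtoC 0) by (intros Q; injection Q; intros; lra).
exists s, (m1, m2); do 7 (split; [assumption|]).
intros z.
assert (X : sigma2_inv (RtoC 0) = (0, 0, 1)).
{ unfold sigma2_inv; rewrite Cmod_0; simpl; f_equal; [f_equal|]; field. }
(* The origin corresponds to the north pole, which the polar form with [0 < t < PI] misses; there
   covariance gives the values. *)
destruct (classic (z = RtoC 0)) as [-> | Hz].
- rewrite Hpw0, Cmult_0_r, X, Nf, Ng, N0.
  change ((0, 0, s) = (s * 0, s * 0, s * 1)); f_equal; [f_equal|]; ring.
- destruct (polar_sigma2_inv z Hz) as (t & phi & Ht & Ez & ->).
  rewrite Ez, Hpw by now apply tan_half_pos.
  destruct (E t phi Ht) as (-> & -> & ->).
  unfold sigma2_inv; rewrite Cmod2_alt; simpl Re; simpl Im.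
  set (T := Rpower (tan_half t) k).
  set (sn := sin (k * phi)); set (cs := cos (k * phi)).
  replace (m1 * (T * cs) - m2 * (T * sn)) with ((m1 * cs - m2 * sn) * T) by ring.
  replace (m1 * (T * sn) + m2 * (T * cs)) with ((m1 * sn + m2 * cs) * T) by ring.
  reflexivity.
Qed.

(** * The real span of the image *)

Ltac componentwise := apply (@f_equal2 (R * (R * R)) (R * R));
  [apply (@f_equal2 R (R * R)); [|apply (@f_equal2 R R)]|apply (@f_equal2 R R)].

(** [linearly_full w] unfolds to [in_span w v] for every [v]. *)
Definition in_span (w : E3 -> E5) (v : E5) : Prop :=
  exists l : list (R * E3),
    (forall p, In p l -> S2 (snd p)) /\
    v = fold_right (fun p acc => plus (scal (fst p) (w (snd p))) acc) zero l.

Lemma in_span_eq w u v : in_span w u -> u = v -> in_span w v.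
Proof.
now intros H <-.
Qed.

Lemma in_span_image w x : S2 x -> in_span w (w x).
Proof.
intros H; exists ((1, x) :: nil); split; [intros p [<-|[]]; exact H|].
simpl; destruct (w x) as [[t [a b]] [a' b']].
change ((t, (a, b), (a', b'))
  = (1 * t + 0, (1 * a + 0, 1 * b + 0), (1 * a' + 0, 1 * b' + 0))).
componentwise; ring.
Qed.

Lemma in_span_plus w u v : in_span w u -> in_span w v -> in_span w (plus u v).
Proof.
intros [l [L Hu]] [l' [L' Hv]]; exists (l ++ l'); split.
- intros p Hp; apply in_app_or in Hp as [?|?]; auto.
- clear L L'; revert u Hu; induction l as [|p l IH]; intros u Hu.
  + transitivity v; [|exact Hv].
    rewrite Hu; destruct v as [[t [a b]] [a' b']].
    change ((0 + t, (0 + a, 0 + b), (0 + a', 0 + b')) = (t, (a, b), (a', b'))).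
    componentwise; ring.
  + simpl in Hu; set (F := fold_right _ _ l) in Hu; specialize (IH F eq_refl).
    transitivity (plus (scal (fst p) (w (snd p))) (plus F v));
      [rewrite Hu | exact (f_equal (fun y : E5 => plus (scal (fst p) (w (snd p))) y) IH)].
    clearbody F; clear.
    destruct (w (snd p)) as [[t1 [a1 b1]] [a1' b1']], p as [r x].
    destruct F as [[t2 [a2 b2]] [a2' b2']], v as [[t [a b]] [a' b']].
    change ((r * t1 + t2 + t, (r * a1 + a2 + a, r * b1 + b2 + b),
        (r * a1' + a2' + a', r * b1' + b2' + b'))
      = (r * t1 + (t2 + t), (r * a1 + (a2 + a), r * b1 + (b2 + b)),
        (r * a1' + (a2' + a'), r * b1' + (b2' + b')))).
    componentwise; ring.
Qed.

Lemma in_span_scal w c v : in_span w v -> in_span w (scal c v).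
Proof.
intros [l [L Hv]]; exists (map (fun p => (c * fst p, snd p)) l); split.
- intros p Hp; apply in_map_iff in Hp as [q [<- Hq]]; exact (L q Hq).
- clear L; revert v Hv; induction l as [|p l IH]; intros v Hv.
  + rewrite Hv; change ((c * 0, (c * 0, c * 0), (c * 0, c * 0)) = (0, (0, 0), (0, 0))).
    componentwise; ring.
  + simpl in Hv; set (F := fold_right _ _ l) in Hv; specialize (IH F eq_refl).
    transitivity (plus (scal (c * fst p) (w (snd p))) (scal c F));
      [rewrite Hv | exact (f_equal (fun y : E5 => plus (scal (c * fst p) (w (snd p))) y) IH)].
    clearbody F; clear.
    destruct (w (snd p)) as [[t1 [a1 b1]] [a1' b1']], p as [r x].
    destruct F as [[t2 [a2 b2]] [a2' b2']].
    change ((c * (r * t1 + t2), (c * (r * a1 + a2), c * (r * b1 + b2)),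
        (c * (r * a1' + a2'), c * (r * b1' + b2')))
      = (c * r * t1 + c * t2, (c * r * a1 + c * a2, c * r * b1 + c * b2),
        (c * r * a1' + c * a2', c * r * b1' + c * b2'))).
    componentwise; ring.
Qed.

Lemma covariant_components w : equivariant w ->
  covariant 0 (fun x => comp0 (w x)) (fun x => comp0 (w x)) /\
  covariant 1 (fun x => Re (comp1 (w x))) (fun x => Im (comp1 (w x))) /\
  covariant 2 (fun x => Re (comp2 (w x))) (fun x => Im (comp2 (w x))).
Proof.
intros H; repeat split; rewrite (H a x) by auto; destruct (w x) as [[t z1] z2];
  rewrite ?Rmult_0_l, ?Rmult_1_l, ?cos_0, ?sin_0;
  unfold comp0, comp1, comp2, Re, Im; simpl; ring.
Qed.

Lemma equivariant_pole w z : equivariant w -> S2 (0, 0, z) ->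
  w (0, 0, z) = (comp0 (w (0, 0, z)), RtoC 0, RtoC 0).
Proof.
intros H Hz; destruct (covariant_components w H) as (_ & H1 & H2).
destruct (covariant_pole 1 _ _ z ltac:(lra) H1 Hz) as [R1 I1].
destruct (covariant_pole 2 _ _ z ltac:(lra) H2 Hz) as [R2 I2].
destruct (w (0, 0, z)) as [[t [x y]] [x' y']]; unfold comp0, comp1, comp2, Re, Im, RtoC in *;
  simpl in *; congruence.
Qed.

Lemma rot_S2 a x : S2 x -> S2 (rot a x).
Proof.
destruct x as [[x1 x2] x3]; unfold S2, rot; intros <-.
pose proof (sin2_cos2 a) as P; unfold Rsqr in P.
transitivity ((sin a * sin a + cos a * cos a) * (x1 ^ 2 + x2 ^ 2) + x3 ^ 2);
  [ring | rewrite P; ring].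
Qed.

(* The projections onto the isotypic components of [R (+) C (+) C] are linear combinations
   of rotations, so the span of the image contains each component on which the image
   does not vanish. *)
Lemma not_full_component w : (forall x, S2 x -> S4 (w x)) -> equivariant w ->
  ~ linearly_full w ->
  (forall x, S2 x -> comp1 (w x) = RtoC 0) \/ (forall x, S2 x -> comp2 (w x) = RtoC 0).
Proof.
intros HS He Hf.
apply NNPP; intros Q; apply not_or_and in Q as [Q1 Q2]; apply Hf.
apply not_all_ex_not in Q1 as [x Q1]; apply imply_to_and in Q1 as [Hx Q1].
apply not_all_ex_not in Q2 as [y Q2]; apply imply_to_and in Q2 as [Hy Q2].
(* The image of the north pole is [(t, 0, 0)] with [t^2 = 1], so scaling it by [t] gives the real
   unit vector. *)
assert (Sp0 : in_span w (1, (0, 0), (0, 0))).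
{ assert (N : S2 (0, 0, 1)) by (unfold S2; ring).
  pose proof (in_span_scal w (comp0 (w (0, 0, 1))) _ (in_span_image w _ N)) as S.
  pose proof (HS _ N) as U; rewrite (equivariant_pole w 1 He N) in S, U.
  set (t := comp0 (w (0, 0, 1))) in *.
  unfold S4 in U; rewrite Cmod_0 in U.
  replace ((1, (0, 0), (0, 0)) : E5) with (scal t ((t, RtoC 0, RtoC 0) : E5)); auto.
  change ((t * t, (t * 0, t * 0), (t * 0, t * 0)) = (1, (0, 0), (0, 0))).
  rewrite Rmult_0_r; replace (t * t) with 1 by lra; reflexivity. }
assert (W : forall a z, S2 z -> exists t a1 b1 a2 b2, w z = (t, (a1, b1), (a2, b2)) /\
  in_span w (t, (cos a * a1 - sin a * b1, cos a * b1 + sin a * a1),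
    (cos (2 * a) * a2 - sin (2 * a) * b2, cos (2 * a) * b2 + sin (2 * a) * a2))).
{ intros a z Hz; pose proof (in_span_image w _ (rot_S2 a z Hz)) as S.
  rewrite (He a z Hz) in S; destruct (w z) as [[t [a1 b1]] [a2 b2]].
  exists t, a1, b1, a2, b2; split; auto. }
(* The rotation of angle [PI] acts by -1 in weight 1 and trivially in weights 0 and 2, so half the
   difference isolates the weight 1 component. *)
assert (Sp1 : forall z, S2 z -> in_span w (0, comp1 (w z), (0, 0))).
{ intros z Hz; destruct (W PI z Hz) as (t & a1 & b1 & a2 & b2 & E & S).
  pose proof (in_span_image w z Hz) as S'; rewrite E in *.
  unfold comp1; simpl fst; simpl snd.
  rewrite cos_2PI, sin_2PI, cos_PI, sin_PI in S.
  pose proof (in_span_plus w _ _ (in_span_scal w (1 / 2) _ S')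
    (in_span_scal w (- (1 / 2)) _ S)) as V.
  refine (in_span_eq w _ _ V _).
  change ((1 / 2 * t + - (1 / 2) * t,
    (1 / 2 * a1 + - (1 / 2) * (-1 * a1 - 0 * b1), 1 / 2 * b1 + - (1 / 2) * (-1 * b1 + 0 * a1)),
    (1 / 2 * a2 + - (1 / 2) * (1 * a2 - 0 * b2), 1 / 2 * b2 + - (1 / 2) * (1 * b2 + 0 * a2)))
    = (0, (a1, b1), (0, 0))).
  componentwise; field. }
(* Half the sum keeps weights 0 and 2, and the real coordinate is removed using [Sp0]. *)
assert (Sp2 : forall z, S2 z -> in_span w (0, (0, 0), comp2 (w z))).
{ intros z Hz; destruct (W PI z Hz) as (t & a1 & b1 & a2 & b2 & E & S).
  pose proof (in_span_image w z Hz) as S'; rewrite E in *; unfold comp2; simpl snd.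
  rewrite cos_2PI, sin_2PI, cos_PI, sin_PI in S.
  pose proof (in_span_plus w _ _ (in_span_scal w (- t) _ Sp0)
    (in_span_plus w _ _ (in_span_scal w (1 / 2) _ S') (in_span_scal w (1 / 2) _ S))) as V.
  refine (in_span_eq w _ _ V _).
  change ((- t * 1 + (1 / 2 * t + 1 / 2 * t),
    (- t * 0 + (1 / 2 * a1 + 1 / 2 * (-1 * a1 - 0 * b1)),
     - t * 0 + (1 / 2 * b1 + 1 / 2 * (-1 * b1 + 0 * a1))),
    (- t * 0 + (1 / 2 * a2 + 1 / 2 * (1 * a2 - 0 * b2)),
     - t * 0 + (1 / 2 * b2 + 1 / 2 * (1 * b2 + 0 * a2))))
    = (0, (0, 0), (a2, b2))).
  componentwise; field. }
assert (NZ : forall a b, (a, b) <> RtoC 0 -> a ^ 2 + b ^ 2 <> 0).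
{ intros a b N Z; apply N; pose proof (pow2_ge_0 a); pose proof (pow2_ge_0 b).
  unfold RtoC; f_equal; apply Rsqr_0_uniq; unfold Rsqr; lra. }
(* A nonzero vector and its quarter turn form an orthogonal basis of the plane; the coefficients are
   the coordinates of [(c1, c2)] in it. *)
assert (Sp1' : forall c1 c2, in_span w (0, (c1, c2), (0, 0))).
{ intros c1 c2.
  pose proof (Sp1 x Hx) as A; pose proof (Sp1 _ (rot_S2 (PI / 2) x Hx)) as B.
  rewrite (He _ x Hx) in B.
  destruct (w x) as [[t [a b]] z2].
  change (in_span w (0, (cos (PI / 2) * a - sin (PI / 2) * b,
    cos (PI / 2) * b + sin (PI / 2) * a), (0, 0))) in B.
  rewrite cos_PI2, sin_PI2 in B; specialize (NZ a b Q1).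
  pose proof (in_span_plus w _ _
    (in_span_scal w ((c1 * a + c2 * b) / (a ^ 2 + b ^ 2)) _ A)
    (in_span_scal w ((c2 * a - c1 * b) / (a ^ 2 + b ^ 2)) _ B)) as V.
  refine (in_span_eq w _ _ V _).
  set (p := (c1 * a + c2 * b) / (a ^ 2 + b ^ 2));
  set (q := (c2 * a - c1 * b) / (a ^ 2 + b ^ 2)).
  change ((p * 0 + q * 0, (p * a + q * (0 * a - 1 * b), p * b + q * (0 * b + 1 * a)),
    (p * 0 + q * 0, p * 0 + q * 0)) = (0, (c1, c2), (0, 0))).
  unfold p, q; componentwise; field; auto. }
(* In weight 2 the quarter turn is produced by the angle [PI / 4]. *)
assert (Sp2' : forall c1 c2, in_span w (0, (0, 0), (c1, c2))).
{ intros c1 c2.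
  pose proof (Sp2 y Hy) as A; pose proof (Sp2 _ (rot_S2 (PI / 4) y Hy)) as B.
  rewrite (He _ y Hy) in B.
  destruct (w y) as [[t z1] [a b]].
  change (in_span w (0, (0, 0), (cos (2 * (PI / 4)) * a - sin (2 * (PI / 4)) * b,
    cos (2 * (PI / 4)) * b + sin (2 * (PI / 4)) * a))) in B.
  replace (2 * (PI / 4)) with (PI / 2) in B by field.
  rewrite cos_PI2, sin_PI2 in B; specialize (NZ a b Q2).
  pose proof (in_span_plus w _ _
    (in_span_scal w ((c1 * a + c2 * b) / (a ^ 2 + b ^ 2)) _ A)
    (in_span_scal w ((c2 * a - c1 * b) / (a ^ 2 + b ^ 2)) _ B)) as V.
  refine (in_span_eq w _ _ V _).
  set (p := (c1 * a + c2 * b) / (a ^ 2 + b ^ 2));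
  set (q := (c2 * a - c1 * b) / (a ^ 2 + b ^ 2)).
  change ((p * 0 + q * 0, (p * 0 + q * 0, p * 0 + q * 0),
    (p * a + q * (0 * a - 1 * b), p * b + q * (0 * b + 1 * a))) = (0, (0, 0), (c1, c2))).
  unfold p, q; componentwise; field; auto. }
intros [[t [a1 b1]] [a2 b2]].
pose proof (in_span_plus w _ _ (in_span_scal w t _ Sp0)
  (in_span_plus w _ _ (Sp1' a1 b1) (Sp2' a2 b2))) as V.
refine (in_span_eq w _ _ V _).
change ((t * 1 + (0 + 0), (t * 0 + (a1 + 0), t * 0 + (b1 + 0)),
  (t * 0 + (0 + a2), t * 0 + (0 + b2))) = (t, (a1, b1), (a2, b2))).
componentwise; ring.
Qed.

(** * Reduction to a single weight and conclusion *)

Lemma gradT_sq_pair_zero k f g t phi : covariant k f g -> smooth_on_S2 f ->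
  smooth_on_S2 g -> (forall x, S2 x -> f x = 0 /\ g x = 0) -> sin t <> 0 ->
  gradT_sq f (sph t phi) + gradT_sq g (sph t phi) = 0.
Proof.
intros H Sf Sg Z S0.
rewrite (gradT_sq_pair k) by auto using smooth_diff.
assert (M : forall h : E3 -> R, (forall x, S2 x -> h x = 0) ->
  meridian h t = 0 /\ Derive (meridian h) t = 0).
{ intros h Zh; split; [apply Zh, meridian_S2|].
  rewrite (Derive_ext _ (fun _ => 0)); [apply Derive_const|].
  intros s; apply Zh, meridian_S2. }
destruct (M f (fun x Hx => proj1 (Z x Hx))) as [-> ->].
destruct (M g (fun x Hx => proj2 (Z x Hx))) as [-> ->].
field; auto.
Qed.

(** The vanishing component contributes nothing to the energy density off the poles, so the density
    of [w] serves as that of the remaining three coordinates. *)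
Lemma equivariant_harmonic_comp1 w : (forall x, S2 x -> S4 (w x)) -> equivariant w ->
  harmonic w -> (forall x, S2 x -> comp2 (w x) = RtoC 0) ->
  equivariant_harmonic 1 (fun x => comp0 (w x)) (fun x => Re (comp1 (w x)))
    (fun x => Im (comp1 (w x))) (energy_density w).
Proof.
intros HS He [Sm Eq] Z; destruct (covariant_components w He) as (C0 & C1 & C2).
unfold coordinates in Sm, Eq.
constructor; auto.
- apply Sm; simpl; auto 6.
- apply (Sm (fun y => Re (comp1 y))); simpl; auto 6.
- apply (Sm (fun y => Im (comp1 y))); simpl; auto 6.
- intros x Hx; pose proof (HS x Hx) as S; specialize (Z x Hx).
  destruct (w x) as [[t z1] z2];
    unfold comp0, comp1, comp2 in *; simpl in Z; rewrite Z in S; unfold S4 in S.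
  rewrite Cmod_0, Cmod2_alt in S; simpl; simpl in S; lra.
- intros x Hx; apply Eq; simpl; auto 6.
- intros x Hx; apply (Eq x Hx (fun y => Re (comp1 y))); simpl; auto 6.
- intros x Hx; apply (Eq x Hx (fun y => Im (comp1 y))); simpl; auto 6.
- intros t phi S0.
  pose proof (gradT_sq_pair_zero 2 (fun x => Re (comp2 (w x))) (fun x => Im (comp2 (w x)))
    t phi C2 ltac:(apply (Sm (fun y => Re (comp2 y))); simpl; auto 6)
    ltac:(apply (Sm (fun y => Im (comp2 y))); simpl; auto 6)
    ltac:(intros x Hx; cbv beta; rewrite Z by auto; auto) S0).
  unfold energy_density, coordinates, sum_list; simpl map; simpl fold_right; lra.
Qed.

Lemma equivariant_harmonic_comp2 w : (forall x, S2 x -> S4 (w x)) -> equivariant w ->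
  harmonic w -> (forall x, S2 x -> comp1 (w x) = RtoC 0) ->
  equivariant_harmonic 2 (fun x => comp0 (w x)) (fun x => Re (comp2 (w x)))
    (fun x => Im (comp2 (w x))) (energy_density w).
Proof.
intros HS He [Sm Eq] Z; destruct (covariant_components w He) as (C0 & C1 & C2).
unfold coordinates in Sm, Eq.
constructor; auto.
- apply Sm; simpl; auto 6.
- apply (Sm (fun y => Re (comp2 y))); simpl; auto 6.
- apply (Sm (fun y => Im (comp2 y))); simpl; auto 6.
- intros x Hx; pose proof (HS x Hx) as S; specialize (Z x Hx).
  destruct (w x) as [[t z1] z2];
    unfold comp0, comp1, comp2 in *; simpl in Z; rewrite Z in S; unfold S4 in S.
  rewrite Cmod_0, Cmod2_alt in S; simpl; simpl in S; lra.
- intros x Hx; apply Eq; simpl; auto 6.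
- intros x Hx; apply (Eq x Hx (fun y => Re (comp2 y))); simpl; auto 6.
- intros x Hx; apply (Eq x Hx (fun y => Im (comp2 y))); simpl; auto 6.
- intros t phi S0.
  pose proof (gradT_sq_pair_zero 1 (fun x => Re (comp1 (w x))) (fun x => Im (comp1 (w x)))
    t phi C1 ltac:(apply (Sm (fun y => Re (comp1 y))); simpl; auto 6)
    ltac:(apply (Sm (fun y => Im (comp1 y))); simpl; auto 6)
    ltac:(intros x Hx; cbv beta; rewrite Z by auto; auto) S0).
  unfold energy_density, coordinates, sum_list; simpl map; simpl fold_right; lra.
Qed.

(** The energy determines [d] only up to sign, whence the choice of [d'] between [d] and [- d]
    according to the degree. *)
Lemma energy_Zabs w (d : Z) k : int_S2 (energy_density w) = 8 * PI * IZR k ->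
  energy w = 4 * PI * IZR (Z.abs d) -> Z.abs d = k.
Proof.
unfold energy; intros -> E; pose proof PI_RGT_0; apply eq_IZR.
apply (Rmult_eq_reg_l (4 * PI)); lra.
Qed.

Lemma sign_IZR s : s = 1 \/ s = -1 -> exists n : Z, (n = 1%Z \/ n = (-1)%Z) /\ s = IZR n.
Proof.
intros [-> | ->]; [exists 1%Z | exists (-1)%Z]; auto.
Qed.

Theorem proposition3p6 :
  forall (w : E3 -> E5) (d : Z),
    (forall x, S2 x -> S4 (w x)) ->
    nonconstant w ->
    equivariant w ->
    harmonic w ->
    ~ linearly_full w ->
    energy w = 4 * PI * IZR (Z.abs d) ->
    exists d' : Z, (d' = d \/ d' = (- d)%Z) /\
    (
      ( (forall x, S2 x -> comp2 (w x) = RtoC 0) /\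
        exists (s : Z) (mu1 : C),
          (s = 1%Z \/ s = (-1)%Z) /\
          deg1 w = IZR d' /\ d' = s /\
          mu1 <> RtoC 0 /\
          w pole2 = scal (IZR s) pole4 /\
          forall z : C,
            w (sigma2_inv z) = scal (IZR s) (omega_eq1 (sigma2_inv (Cmult mu1 z))) )
    \/
      ( (forall x, S2 x -> comp1 (w x) = RtoC 0) /\
        exists (s : Z) (mu2 : C),
          (s = 1%Z \/ s = (-1)%Z) /\
          deg2 w = IZR d' /\ d' = (2 * s)%Z /\
          mu2 <> RtoC 0 /\
          w pole2 = scal (IZR s) pole4 /\
          forall z : C,
            w (sigma2_inv z) =
            scal (IZR s) (omega_eq2 (sigma2_inv (Cmult mu2 (Cmult z z)))) )
    ).
Proof.
intros w d HS Hn He Hh Hf HE.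
(* If the weight 1 component vanishes the power map is squaring; if the weight 2 component vanishes
   it is the identity. *)
destruct (not_full_component w HS He Hf) as [Z|Z].
- assert (Hpw : forall T phi, 0 < T -> Cmult (T * cos phi, T * sin phi)
    (T * cos phi, T * sin phi) = (Rpower T 2 * cos (2 * phi), Rpower T 2 * sin (2 * phi))).
  { intros T phi HT; replace (Rpower T 2) with (T ^ 2)
      by (rewrite <- Rpower_pow by exact HT; f_equal; simpl; ring).
    unfold Cmult; simpl fst; simpl snd; rewrite cos_2a, sin_2a; f_equal; ring. }
  destruct (equivariant_harmonic_sigma2 2 _ _ _ _ (fun z => Cmult z z) ltac:(lra)
    Hpw (Cmult_0_l _) (equivariant_harmonic_comp2 w HS He Hh Z))
    as [[c K]|(s & mu & Hs & Hmu & I & D & P0 & P1 & P2 & F)].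
  { exfalso; apply Hn; exists (c, RtoC 0, RtoC 0); intros x Hx.
    destruct (K x Hx) as (K0 & K1 & K2); specialize (Z x Hx).
    destruct (w x) as [[t z1] [a b]];
      unfold comp0, comp1, comp2, Re, Im, RtoC in *; simpl in *; congruence. }
  destruct (sign_IZR s Hs) as [n [Hn' ->]].
  pose proof (energy_Zabs w d 2 I HE) as A.
  exists (2 * n)%Z; split; [lia|right; split; [exact Z|]].
  exists n, mu; split; [exact Hn'|]; split; [|split; [reflexivity|split; [exact Hmu|split]]].
  + unfold deg2; rewrite D, mult_IZR; ring.
  (* The real coordinate at the south pole is minus the sign, and that of [pole4] is -1, so the sign
     multiplies [pole4]. *)
  + specialize (Z pole2 ltac:(unfold S2, pole2; ring)).
    destruct (w pole2) as [[t z1] [a b]];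
      unfold comp0, comp1, comp2, Re, Im in *; simpl in *; rewrite Z, P0, P1, P2.
    change ((- IZR n, (0, 0), (0, 0))
      = (IZR n * -1, (IZR n * 0, IZR n * 0), (IZR n * 0, IZR n * 0))).
    componentwise; ring.
  + intros z; specialize (F z); specialize (Z _ (proj1 (sigma2_inv_S2 z))).
    destruct (sigma2_inv (Cmult mu (Cmult z z))) as [[x1 x2] x3].
    destruct (w (sigma2_inv z)) as [[t z1] [a b]];
      unfold comp0, comp1, comp2, Re, Im in *; simpl in *.
    injection F; intros -> -> ->; rewrite Z.
    change ((IZR n * x3, (0, 0), (IZR n * x1, IZR n * x2))
      = (IZR n * x3, (IZR n * 0, IZR n * 0), (IZR n * x1, IZR n * x2))).
    now rewrite Rmult_0_r.
- assert (Hpw : forall T phi, 0 < T -> (T * cos phi, T * sin phi)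
    = (Rpower T 1 * cos (1 * phi), Rpower T 1 * sin (1 * phi)))
    by (intros T phi HT; now rewrite Rpower_1, !Rmult_1_l by exact HT).
  destruct (equivariant_harmonic_sigma2 1 _ _ _ _ (fun z => z) ltac:(lra)
    Hpw eq_refl (equivariant_harmonic_comp1 w HS He Hh Z))
    as [[c K]|(s & mu & Hs & Hmu & I & D & P0 & P1 & P2 & F)].
  { exfalso; apply Hn; exists (c, RtoC 0, RtoC 0); intros x Hx.
    destruct (K x Hx) as (K0 & K1 & K2); specialize (Z x Hx).
    destruct (w x) as [[t [a b]] z2];
      unfold comp0, comp1, comp2, Re, Im, RtoC in *; simpl in *; congruence. }
  destruct (sign_IZR s Hs) as [n [Hn' ->]].
  pose proof (energy_Zabs w d 1 I HE) as A.
  exists n; split; [lia|left; split; [exact Z|]].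
  exists n, mu; split; [exact Hn'|]; split; [|split; [reflexivity|split; [exact Hmu|split]]].
  + unfold deg1; rewrite D; ring.
  + specialize (Z pole2 ltac:(unfold S2, pole2; ring)).
    destruct (w pole2) as [[t [a b]] z2];
      unfold comp0, comp1, comp2, Re, Im in *; simpl in *; rewrite Z, P0, P1, P2.
    change ((- IZR n, (0, 0), (0, 0))
      = (IZR n * -1, (IZR n * 0, IZR n * 0), (IZR n * 0, IZR n * 0))).
    componentwise; ring.
  + intros z; specialize (F z); specialize (Z _ (proj1 (sigma2_inv_S2 z))).
    destruct (sigma2_inv (Cmult mu z)) as [[x1 x2] x3].
    destruct (w (sigma2_inv z)) as [[t [a b]] z2];
      unfold comp0, comp1, comp2, Re, Im in *; simpl in *.
    injection F; intros -> -> ->; rewrite Z.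
    change ((IZR n * x3, (IZR n * x1, IZR n * x2), (0, 0))
      = (IZR n * x3, (IZR n * x1, IZR n * x2), (IZR n * 0, IZR n * 0))).
    now rewrite Rmult_0_r.
Qed.
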